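(* Let $$L(\lambda)=\begin{bmatrix} \lambda A_1-A_0 & B_0-\lambda B_1\\ \lambda C_1-C_0 & \lambda D_1-D_0\end{bmatrix}$$ be a linear system pencil, with $\lambda A_1-A_0$ a regular $d\times d$ complex pencil, $B_0,B_1\in\mathbb{C}^{d\times n}$, $C_0,C_1\in\mathbb{C}^{m\times d}$, $D_0,D_1\in\mathbb{C}^{m\times n}$, realizing the transfer function $$R(\lambda):=(\lambda D_1-D_0)+(\lambda C_1-C_0)(\lambda A_1-A_0)^{-1}(\lambda B_1-B_0).$$ If $L(\lambda)$ is strongly minimal, then it is strongly irreducible. Moreover, if $L(\lambda)$ is strongly irreducible, then: 1. the zero structure of $R(\lambda)$ at finite and infinite $\lambda$ is the same as the zero structure of $L(\lambda)$ at finite and infinite $\lambda$; 2. the left and right minimal indices of $R(\lambda)$ and $L(\lambda)$ are the same; 3. the finite polar structure of $R(\lambda)$ is the same as the finite zero structure of $\lambda A_1-A_0$; 4. the infinite polar structure of $R(\lambda)$ is the same as the infinite zero structure of the pencil $$\begin{bmatrix} \lambda A_1-A_0 & -\lambda B_1 & 0\\ \lambda C_1 & \lambda D_1 & -I_m\\ 0 & I_n & 0\end{bmatrix}.$$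
   Context: A square pencil is regular if its determinant is not identically zero. The normal rank of a rational matrix is the size of its largest minor that is not identically zero. Zero and polar structure (McMillan sense): for a $p\times q$ rational matrix $M(\lambda)$ of normal rank $r$ and a point $\lambda_0\in\mathbb{C}\cup\{\infty\}$, there are rational matrices $M_\ell,M_r$, regular at $\lambda_0$ (bounded and invertible there), such that $M_\ell MM_r$ has leading $r\times r$ block $\mathrm{diag}((\lambda-\lambda_0)^{d_1},\dots,(\lambda-\lambda_0)^{d_r})$, $d_1\le\dots\le d_r$, and zeros elsewhere; if $\lambda_0=\infty$, the factor $\lambda-\lambda_0$ is replaced by $1/\lambda$. The uniquely determined integers $d_i$ are the structural indices of $M$ at $\lambda_0$. The strictly positive ones correspond to a zero at $\lambda_0$ and their list is the zero structure of $M$ at $\lambda_0$; the strictly negative ones correspond to a pole at $\lambda_0$ and the list of their absolute values is the polar (pole) structure of $M$ at $\lambda_0$. Pencils are viewed as rational matrices. A polar structure is the same as a zero structure when the corresponding lists of positive integers (with repetition) at each point considered coincide. Minimal indices: the left null space $\{y(\lambda)^T\in\mathbb{C}(\lambda)^{1\times p}: y^TM\equiv 0\}$ and right null space $\{x(\lambda)\in\mathbb{C}(\lambda)^{q\times 1}: Mx\equiv 0\}$ are vector spaces over $\mathbb{C}(\lambda)$. A minimal basis of such a space is a basis consisting of polynomial vectors whose sum of degrees is minimal among all polynomial bases; the ordered list of degrees is independent of the minimal basis. These degrees are the left (respectively right) minimal indices of $M$. Strongly minimal: $L(\lambda)$ is strongly minimal if the pencils $$\begin{bmatrix} \lambda A_1-A_0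 & B_0-\lambda B_1\end{bmatrix},\qquad \begin{bmatrix} \lambda A_1-A_0\\ \lambda C_1-C_0\end{bmatrix}$$ have no finite or infinite eigenvalues (considered as polynomial matrices of grade $1$, the degree of the linear system matrix). Here $\lambda_0\in\mathbb{C}$ is a finite eigenvalue of a (possibly rectangular) pencil $P(\lambda)=\lambda P_1-P_0$ if $\operatorname{rank}P(\lambda_0)$ is smaller than the normal rank of $P$; $P$ has an infinite eigenvalue if $0$ is an eigenvalue of $\lambda P(1/\lambda)=P_1-\lambda P_0$, i.e. if $\operatorname{rank}P_1$ is smaller than the normal rank of $P$. Strongly irreducible: $L(\lambda)$ is strongly irreducible if the pencils $$\begin{bmatrix} \lambda A_1-A_0 & B_0-\lambda B_1 & 0\\ \lambda C_1-C_0 & \lambda D_1-D_0 & -I_m\end{bmatrix},\qquad \begin{bmatrix} \lambda A_1-A_0 & B_0-\lambda B_1\\ \lambda C_1-C_0 & \lambda D_1-D_0\\ 0 & I_n\end{bmatrix}$$ have no finite or infinite zeros (in the McMillan sense above). *)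

(* Defs.v *)
From HB Require Import structures.
From mathcomp Require Import all_boot all_order all_algebra.
From mathcomp Require Import boolp classical_sets.

Set Implicit Arguments.
Unset Strict Implicit.
Unset Printing Implicit Defensive.

Import Order.TTheory GRing.Theory Num.Theory.
Local Open Scope ring_scope.

Notation ratfun F := {fraction {poly F}}.
Notation frac := (@FracField.tofrac _).

Definition pencil (F : fieldType) (p q : nat) (P1 P0 : 'M[F]_(p, q)) :
    'M[{poly F}]_(p, q) :=
  'X *: map_mx polyC P1 - map_mx polyC P0.

Definition ratmx (F : fieldType) (p q : nat) (P : 'M[{poly F}]_(p, q)) :
    'M[ratfun F]_(p, q) :=
  map_mx frac P.

(* Row and column selections need not be increasing: up to sign this adds only
   minors with a repeated line, which vanish. *)
Definition normal_rank (F : fieldType) (p q : nat) (M : 'M[ratfun F]_(p, q)) :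
    nat :=
  \max_(k < (minn p q).+1 |
        [exists f : {ffun 'I_k -> 'I_p}, exists g : {ffun 'I_k -> 'I_q},
           \det (mxsub f g M) != 0]) k.

(** * Zero and polar structure *)

Inductive point (F : Type) : Type := FinitePoint (a : F) | InfinitePoint.
Arguments FinitePoint {F} a.
Arguments InfinitePoint {F}.

(* [value_at f x c]: [f] is bounded at [x], with value [c] there.  At infinity,
   the value of a proper fraction is the quotient of the coefficients of the
   highest degree occurring in the denominator. *)
Definition value_at (F : fieldType) (f : ratfun F) (x : point F) (c : F) :
    Prop :=
  exists n e : {poly F}, f = frac n / frac e /\
  match x with
  | FinitePoint a => e.[a] != 0 /\ c = n.[a] / e.[a]
  | InfinitePoint => [/\ e != 0, (size n <= size e)%N &
                    c = n`_(size e).-1 / lead_coef e]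
  end.

Definition regular_at (F : fieldType) (p : nat) (U : 'M[ratfun F]_p)
    (x : point F) : Prop :=
  exists2 U0 : 'M[F]_p, U0 \in unitmx & forall i j, value_at (U i j) x (U0 i j).

Definition local_parameter (F : fieldType) (x : point F) : ratfun F :=
  match x with
  | FinitePoint a => frac ('X - a%:P)
  | InfinitePoint => (frac 'X)^-1
  end.

Definition is_structural_indices (F : fieldType) (p q : nat)
    (M : 'M[ratfun F]_(p, q)) (x : point F) (ds : seq int) : Prop :=
  [/\ size ds = normal_rank M,
      sorted <=%R ds &
      exists (Ml : 'M[ratfun F]_p) (Mr : 'M[ratfun F]_q),
        [/\ regular_at Ml x, regular_at Mr x &
            Ml *m M *m Mr =
            \matrix_(i, j) if (i == j :> nat) && (i < size ds)%N
                           then local_parameter x ^ ds`_i else 0]].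

(* Such a list exists and is unique (local Smith-McMillan form), so that the
   default value [::] is never used. *)
Definition structural_indices (F : fieldType) (p q : nat)
    (M : 'M[ratfun F]_(p, q)) (x : point F) : seq int :=
  xget [::] [set ds | is_structural_indices M x ds]%classic.

Definition zero_structure (F : fieldType) (p q : nat)
    (M : 'M[ratfun F]_(p, q)) (x : point F) : seq int :=
  [seq d <- structural_indices M x | 0 < d].

(* Reversed so as to be in increasing order, like [zero_structure]. *)
Definition polar_structure (F : fieldType) (p q : nat)
    (M : 'M[ratfun F]_(p, q)) (x : point F) : seq int :=
  rev [seq `|d| | d <- structural_indices M x & d < 0].

Definition has_no_zeros (F : fieldType) (p q : nat)
    (M : 'M[ratfun F]_(p, q)) : Prop :=
  forall x : point F, zero_structure M x = [::].

(** * Minimal indices *)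

Definition left_null_space (F : fieldType) (p q : nat)
    (M : 'M[ratfun F]_(p, q)) : {vspace 'rV[ratfun F]_p} :=
  lker (linfun (mulmxr M)).

Definition right_null_space (F : fieldType) (p q : nat)
    (M : 'M[ratfun F]_(p, q)) : {vspace 'cV[ratfun F]_q} :=
  lker (linfun (mulmx M)).

Definition vdegree (F : fieldType) (p q : nat) (v : 'M[{poly F}]_(p, q)) : nat :=
  \max_(i < p) \max_(j < q) (size (v i j)).-1.

Definition polynomial_basis (F : fieldType) (p q : nat)
    (V : {vspace 'M[ratfun F]_(p, q)}) (b : seq 'M[{poly F}]_(p, q)) : Prop :=
  basis_of V [seq ratmx v | v <- b].

Definition minimal_basis (F : fieldType) (p q : nat)
    (V : {vspace 'M[ratfun F]_(p, q)}) (b : seq 'M[{poly F}]_(p, q)) : Prop :=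
  polynomial_basis V b /\
  forall b', polynomial_basis V b' ->
    (\sum_(v <- b) vdegree v <= \sum_(v <- b') vdegree v)%N.

(* A minimal basis exists and its ordered degrees do not depend on the choice
   of that basis, so that the default value [::] is never used. *)
Definition minimal_indices (F : fieldType) (p q : nat)
    (V : {vspace 'M[ratfun F]_(p, q)}) : seq nat :=
  xget [::] [set s | exists2 b, minimal_basis V b &
                     s = sort leq [seq vdegree v | v <- b]]%classic.

Definition left_minimal_indices (F : fieldType) (p q : nat)
    (M : 'M[ratfun F]_(p, q)) : seq nat :=
  minimal_indices (left_null_space M).

Definition right_minimal_indices (F : fieldType) (p q : nat)
    (M : 'M[ratfun F]_(p, q)) : seq nat :=
  minimal_indices (right_null_space M).

(** * Linear system pencils *)

Definition finite_eigenvalue (F : fieldType) (p q : nat)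
    (P : 'M[{poly F}]_(p, q)) (a : F) : Prop :=
  (\rank (map_mx (horner_eval a) P) < normal_rank (ratmx P))%N.

(* As a matrix polynomial of grade 1: the value at 0 of the reversal of [P] is
   its coefficient of degree 1. *)
Definition infinite_eigenvalue (F : fieldType) (p q : nat)
    (P : 'M[{poly F}]_(p, q)) : Prop :=
  (\rank (map_mx (coefp 1) P) < normal_rank (ratmx P))%N.

Definition has_no_eigenvalues (F : fieldType) (p q : nat)
    (P : 'M[{poly F}]_(p, q)) : Prop :=
  (forall a, ~ finite_eigenvalue P a) /\ ~ infinite_eigenvalue P.

(* Below, A, B, C, D stand for the pencils x A_1 - A_0, x B_1 - B_0,
   x C_1 - C_0, x D_1 - D_0; in particular B_0 - x B_1 is - B. *)

Definition system_pencil (F : fieldType) (d m n : nat)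
    (A : 'M[{poly F}]_d) (B : 'M[{poly F}]_(d, n))
    (C : 'M[{poly F}]_(m, d)) (D : 'M[{poly F}]_(m, n)) :
    'M[{poly F}]_(d + m, d + n) :=
  block_mx A (- B) C D.

Definition transfer_function (F : fieldType) (d m n : nat)
    (A : 'M[{poly F}]_d) (B : 'M[{poly F}]_(d, n))
    (C : 'M[{poly F}]_(m, d)) (D : 'M[{poly F}]_(m, n)) :
    'M[ratfun F]_(m, n) :=
  ratmx D + ratmx C *m invmx (ratmx A) *m ratmx B.

Definition strongly_minimal (F : fieldType) (d m n : nat)
    (A : 'M[{poly F}]_d) (B : 'M[{poly F}]_(d, n))
    (C : 'M[{poly F}]_(m, d)) : Prop :=
  has_no_eigenvalues (row_mx A (- B)) /\ has_no_eigenvalues (col_mx A C).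

Definition strongly_irreducible (F : fieldType) (d m n : nat)
    (A : 'M[{poly F}]_d) (B : 'M[{poly F}]_(d, n))
    (C : 'M[{poly F}]_(m, d)) (D : 'M[{poly F}]_(m, n)) : Prop :=
  has_no_zeros (ratmx (row_mx (block_mx A (- B) C D)
                              (col_mx 0 (- (1%:M : 'M_m))))) /\
  has_no_zeros (ratmx (col_mx (block_mx A (- B) C D)
                              (row_mx 0 (1%:M : 'M_n)))).

Definition infinite_pole_pencil (F : fieldType) (d m n : nat)
    (A : 'M[{poly F}]_d) (B1 : 'M[F]_(d, n)) (C1 : 'M[F]_(m, d))
    (D1 : 'M[F]_(m, n)) : 'M[{poly F}]_((d + m) + n, (d + n) + m) :=
  block_mx (block_mx A (- pencil B1 0) (pencil C1 0) (pencil D1 0))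
             (col_mx 0 (- (1%:M : 'M_m)))
           (row_mx 0 (1%:M : 'M_n)) 0.

(* Main.v *)
From mathcomp Require Import all_boot all_order all_algebra.
From mathcomp Require Import perm ring.
From mathcomp Require Import boolp classical_sets.
From mathcomp Require Import reals complex.
Require Import Defs.

(** At a point of the projective line, the fractions that are bounded there form a
    discrete valuation ring, and structural indices are the exponents of the
    Smith form over this ring. All matrices that are bounded at the point are
    called integral below. A matrix of full row rank has no zero at a point
    exactly when it has an integral right inverse ([has_no_zerosP]). Strong
    irreducibility therefore means that, at every point, infinity included,
    there are integral solutions of

      [L X1 + G X2 = 1] and [Y1 L + Y2 H = 1],

    where [L] is the system pencil, [G = (0; - 1)] and [H = (0, 1)]
    ([strongly_irreducibleP]). Besides, elimination with [A] gives, for the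
    transfer function [T], [Z = (A^-1 B; 1)] and [W = (- C A^-1, 1)],

      [L Z = - G T], [H Z = 1], [W L = T H] and [W G = - 1].

    The comparison of [T] and [L] follows from these six identities alone, at a
    finite point and at infinity by the same argument.

    Zeros. The number of structural indices at least [k] is the largest size of a
    [zero_witness], a perfect pairing at the residue field between integral
    vectors of the image and integral functionals that are divisible by the [k]-th
    power of the local parameter on the image of integral vectors. Witnesses for
    [T] and for [L] are converted into each other with [Z], [W] and the Bezout
    identities, as long as [k > 0] ([zero_structure_realization]).

    Poles. Likewise, the number of indices at most [- k] is the largest size of a
    [pole_witness]. If [T = D + C S^-1 B] with [B], [C], [D] integral and Bezout
    identities for [S], [B] and for [S], [C], then the poles of [T] are the zeros
    of [S] ([polar_structure_realization]). At a finite point, [S] is [A]. At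
    infinity, the pencils [B], [C] and [D] are not integral, but only their
    constant terms need to be moved into the integral data; this turns [S] into
    a bordered pencil ([polar_structure_bordered]).

    Minimal indices. [Z] and [H] are mutually inverse between the kernels of [T]
    and of [L]. On the kernel of [T], [Z] agrees with [Y2], which is integral at
    any chosen point. Integrality at all finite points preserves polynomial
    vectors, and integrality at infinity keeps the degree from growing
    ([right_minimal_indices_realization]). Transposition gives the other side.

    Strong minimality. The absence of eigenvalues of [(A, - B)] gives an integral
    right inverse, at infinity even one that is a multiple of the local
    parameter. Its product with [(C, D)] is thus still integral
    ([pencil_right_inverse]), and the Bezout identities can be completed. *)

Set Implicit Arguments.
Unset Strict Implicit.
Unset Printing Implicit Defensive.

Import Order.TTheory GRing.Theory Num.Theory.
Local Open Scope ring_scope.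

(** * Places of a field *)

(** The residue map of a discrete valuation ring of [K] with residue field [F],
    as a relation: an element of [K] belongs to the ring when it has a value.
    [value_decomp] says that [param] generates the maximal ideal and that [K]
    is the fraction field; [valueC] is a set-theoretic section of the residue
    map, normalised so that [0] and [1] are among the lifts. *)
Record place (K F : fieldType) := Place {
  value :> K -> F -> Prop;
  param : K;
  valueC : exists2 C : F -> K, forall c, value (C c) c & C 0 = 0 /\ C 1 = 1;
  value_fun : forall f c d, value f c -> value f d -> c = d;
  valueD : forall f g c d, value f c -> value g d -> value (f + g) (c + d);
  valueM : forall f g c d, value f c -> value g d -> value (f * g) (c * d);
  valueN : forall f c, value f c -> value (- f) (- c);
  valueV : forall f c, value f c -> c != 0 -> value f^-1 c^-1;
  param_neq0 : param != 0;
  value_param : value param 0;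
  value_decomp : forall f, f != 0 ->
    exists (i : int) g c, [/\ f = param ^ i * g, value g c & c != 0]
}.

Section PointPlace.
Variables (F : fieldType) (x : point F).
Implicit Types (f g : ratfun F) (p q : {poly F}) (c : F).

Lemma ratfun_quotient f : exists p q, q != 0 /\ f = frac p / frac q.
Proof.
elim/quotW: f => r; exists \n_r, \d_r; split; first exact: denom_ratioP.
have dr0 : frac \d_r != 0 by rewrite tofrac_eq0 denom_ratioP.
apply: (mulIf dr0); rewrite divfK //.
apply/eqP; rewrite -[_ * _]/(FracField.mul _ _) !piE.
rewrite FracField.equivfE /FracField.mulf !numden_Ratio ?mulf_neq0 ?oner_eq0
  ?denom_ratioP //.
by rewrite !mulr1 mulrC.
Qed.

(** Uniform access to [value_at]: values at infinity behave like evaluation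
    once a bound [k] on the degree is fixed and the coefficient of that degree
    is read off, because these coefficients multiply when the bounds add up. *)
Definition leading_at (k : nat) p c : Prop :=
  match x with
  | FinitePoint a => p.[a] = c
  | InfinitePoint => (size p <= k.+1)%N /\ p`_k = c
  end.

Lemma leading_at0 k : leading_at k 0 0.
Proof. by rewrite /leading_at; case: x => [a|]; rewrite ?horner0 ?size_poly0 ?coef0. Qed.

Lemma leading_atC c : leading_at 0 c%:P c.
Proof.
by rewrite /leading_at; case: x => [a|]; rewrite ?hornerC ?size_polyC ?coefC;
  case: (c != 0).
Qed.

Lemma leading_atD k p q c d :
  leading_at k p c -> leading_at k q d -> leading_at k (p + q) (c + d).
Proof.
rewrite /leading_at; case: x => [a|]; first by move=> <- <-; rewrite hornerD.
move=> [sp <-] [sq <-]; rewrite coefD; split=> //.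
by rewrite (leq_trans (size_polyD _ _)) // geq_max sp.
Qed.

Lemma leading_atN k p c : leading_at k p c -> leading_at k (- p) (- c).
Proof.
by rewrite /leading_at; case: x => [a|];
  [move=> <-; rewrite hornerN | rewrite size_polyN coefN => -[? <-]].
Qed.

Lemma leading_atM k l p q c d :
  leading_at k p c -> leading_at l q d -> leading_at (k + l) (p * q) (c * d).
Proof.
rewrite /leading_at; case: x => [a|]; first by move=> <- <-; rewrite hornerM.
move=> [sp <-] [sq <-]; split.
  rewrite (leq_trans (size_polyMleq _ _)) // -subn1 leq_subLR add1n -addnS -addSn.
  exact: leq_add.
have lt_k : (k < (k + l).+1)%N by rewrite ltnS leq_addr.
rewrite coefM (bigD1 (Ordinal lt_k)) //= addKn big1 ?addr0 // => i ne_ik.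
have [lt_ik | le_ki] := ltnP i k.
  rewrite [q`_ _]nth_default ?mulr0 // (leq_trans sq) //.
  by rewrite ltn_subRL ltn_add2r.
rewrite [p`_ _]nth_default ?mul0r // (leq_trans sp) // ltn_neqAle le_ki andbT.
by rewrite eq_sym; apply: contraNneq ne_ik => eq_ik; apply/eqP/val_inj.
Qed.

Lemma leading_at_inj k p c d : leading_at k p c -> leading_at k p d -> c = d.
Proof. by rewrite /leading_at; case: x => [a <- <-|[_ <-] [_ <-]]. Qed.

Lemma leading_at_neq0 k p c : leading_at k p c -> c != 0 -> p != 0.
Proof.
move=> lp; apply: contraNneq => p0; move: lp; rewrite p0 => lp.
by rewrite (leading_at_inj lp (leading_at0 k)).
Qed.

Lemma value_atP f c :
  value_at f x c <->
  exists k p q cp cq, [/\ f = frac p / frac q, leading_at k p cp,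
                          leading_at k q cq, cq != 0 & c = cp / cq].
Proof.
rewrite /value_at /leading_at; case: x => [a|]; split.
- by move=> [n [e [-> [ea ->]]]]; exists 0%N, n, e, n.[a], e.[a]; split.
- by move=> [k [n [e [cp [cq [-> <- <- e0 ->]]]]]]; exists n, e.
- move=> [n [e [-> [e0 sne ->]]]]; exists (size e).-1, n, e, n`_(size e).-1, (lead_coef e).
  have se : (size e).-1.+1 = size e by rewrite prednK // lt0n size_poly_eq0.
  by split; rewrite ?se ?lead_coef_eq0.
move=> [k [n [e [cp [cq [-> [sn <-] [se <-] e0 ->]]]]]]; exists n, e; split=> //.
have ek : size e = k.+1.
  by apply/eqP; rewrite eqn_leq se ltnNge; apply: contra e0 => ?; rewrite nth_default.
by rewrite /lead_coef ek; split=> //; rewrite -size_poly_gt0 ek.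
Qed.

Lemma frac_neq0 k q c : leading_at k q c -> c != 0 -> frac q != 0 :> ratfun F.
Proof. by move=> lq c0; rewrite tofrac_eq0 (leading_at_neq0 lq). Qed.

Lemma value_atC c : value_at (frac c%:P) x c.
Proof.
apply/value_atP; exists 0%N, c%:P, 1%:P, c, 1.
by split; rewrite ?oner_eq0 ?tofrac1 ?divr1 //; apply: leading_atC.
Qed.

Lemma value_at1 : value_at 1 x 1.
Proof. by have := value_atC 1; rewrite polyC1 tofrac1. Qed.

Lemma value_atD f g c d : value_at f x c -> value_at g x d -> value_at (f + g) x (c + d).
Proof.
move=> /value_atP[k [p [q [cp [cq [-> lp lq q0 ->]]]]]].
move=> /value_atP[l [p' [q' [cp' [cq' [-> lp' lq' q0' ->]]]]]].
apply/value_atP; exists (k + l)%N, (p * q' + p' * q), (q * q'), (cp * cq' + cp' * cq),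
  (cq * cq').
split; rewrite ?mulf_neq0 //.
- rewrite (tofracD (p * q') (p' * q)) (tofracM p q') (tofracM p' q) (tofracM q q').
  exact: addf_div (frac_neq0 lq q0) (frac_neq0 lq' q0').
- by apply: leading_atD; last rewrite addnC; apply: leading_atM.
- exact: leading_atM.
- by rewrite addf_div.
Qed.

Lemma value_atN f c : value_at f x c -> value_at (- f) x (- c).
Proof.
move=> /value_atP[k [p [q [cp [cq [-> lp lq q0 ->]]]]]].
apply/value_atP; exists k, (- p), q, (- cp), cq; rewrite tofracN !mulNr.
by split=> //; apply: leading_atN.
Qed.

Lemma value_atM f g c d : value_at f x c -> value_at g x d -> value_at (f * g) x (c * d).
Proof.
move=> /value_atP[k [p [q [cp [cq [-> lp lq q0 ->]]]]]].
move=> /value_atP[l [p' [q' [cp' [cq' [-> lp' lq' q0' ->]]]]]].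
apply/value_atP; exists (k + l)%N, (p * p'), (q * q'), (cp * cp'), (cq * cq').
by split; rewrite ?mulf_neq0 //;
  [rewrite (tofracM p p') (tofracM q q') | apply: leading_atM..|]; rewrite ?mulf_div.
Qed.

Lemma value_atV f c : value_at f x c -> c != 0 -> value_at f^-1 x c^-1.
Proof.
move=> /value_atP[k [p [q [cp [cq [-> lp lq q0 ->]]]]]] c0.
apply/value_atP; exists k, q, p, cq, cp; split; rewrite ?invf_div //.
by apply: contraNneq c0 => ->; rewrite mul0r.
Qed.

Lemma value_at_inj f c d : value_at f x c -> value_at f x d -> c = d.
Proof.
move=> /value_atP[k [p [q [cp [cq [-> lp lq q0 ->]]]]]].
move=> /value_atP[l [p' [q' [cp' [cq' [eq_f lp' lq' q0' ->]]]]]].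
apply/eqP; rewrite eqr_div //; apply/eqP.
have := eqr_div (frac p) (frac p') (frac_neq0 lq q0) (frac_neq0 lq' q0').
rewrite eq_f eqxx -(tofracM p q') -(tofracM p' q) tofrac_eq => /esym/eqP eq_pq.
apply: (@leading_at_inj (k + l) (p * q')); first exact: leading_atM.
by rewrite eq_pq addnC; apply: leading_atM.
Qed.

Local Notation pi := (local_parameter x).

Lemma local_parameter_neq0 : pi != 0.
Proof. by case: x => [a|] /=; rewrite ?invr_eq0 tofrac_eq0 ?polyXsubC_eq0 ?polyX_eq0. Qed.

Lemma value_at_local_parameter : value_at pi x 0.
Proof.
apply/value_atP; rewrite /leading_at; case: x => [a|] /=.
  exists 0%N, ('X - a%:P), 1, 0, 1; rewrite !hornerE subrr tofrac1 !divr1 oner_eq0.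
  by split.
exists 1%N, 1, 'X, 0, 1; rewrite tofrac1 mul0r mul1r oner_eq0 size_polyX size_polyC coefX
  coef1 /=.
by split=> //; split=> //; case: eqP.
Qed.

Lemma frac_decomp p : p != 0 ->
  exists (i : int) f c, [/\ frac p = pi ^ i * f, value_at f x c & c != 0].
Proof.
case: x => [a|] p0 /=.
  have [m [q]] := multiplicity_XsubC p a; rewrite p0 /= => qa ->.
  exists m%:Z, (frac q), q.[a]; split; last exact: qa.
    by rewrite tofracM tofracXn mulrC.
  by exists q, 1; rewrite tofrac1 divr1 !hornerE oner_eq0 divr1.
exists (- ((size p).-1)%:Z), (frac p / frac 'X ^+ (size p).-1), (lead_coef p).
split; last by rewrite lead_coef_eq0.
  rewrite -exprz_inv invrK mulrC divfK // expf_neq0 // tofrac_eq0 polyX_eq0 //.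
exists p, ('X^((size p).-1)); rewrite tofracXn expf_eq0 polyX_eq0 andbF.
by rewrite size_polyXn lead_coefXn divr1 prednK ?size_poly_gt0.
Qed.

Lemma value_at_decomp f : f != 0 ->
  exists (i : int) g c, [/\ f = pi ^ i * g, value_at g x c & c != 0].
Proof.
have [p [q [q0 ->]]] := ratfun_quotient f => pq0.
have p0 : p != 0 by apply: contraNneq pq0 => ->; rewrite tofrac0 mul0r.
have [i [g [c [-> gc c0]]]] := frac_decomp p0.
have [j [h [d [-> hd d0]]]] := frac_decomp q0.
exists (i - j), (g / h), (c / d); split.
- by rewrite invfM mulrACA expfzDr ?local_parameter_neq0 // invr_expz.
- by apply: value_atM => //; apply: value_atV.
- by rewrite mulf_neq0 ?invr_eq0.
Qed.

Lemma value_at_constants :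
  exists2 C : F -> ratfun F, forall c, value_at (C c) x c & C 0 = 0 /\ C 1 = 1.
Proof.
exists (fun c => frac c%:P); first exact: value_atC.
by rewrite polyC0 polyC1 tofrac0 tofrac1.
Qed.

(** Every point of the projective line gives a place, so that finite points and
    infinity are treated by the same arguments from here on. *)
Definition point_place : place (ratfun F) F :=
  Place value_at_constants value_at_inj value_atD value_atM value_atN value_atV
        local_parameter_neq0 value_at_local_parameter value_at_decomp.

End PointPlace.

(** * Matrices over a place *)

Section LocalMatrices.
Variables (K F : fieldType) (v : place K F).
Local Notation pi := (param v).

Lemma value0 : v 0 0.
Proof. by have [C vC [C0 _]] := valueC v; rewrite -[X in v X]C0. Qed.

Lemma value1 : v 1 1.
Proof. by have [C vC [_ C1]] := valueC v; rewrite -[X in v X]C1. Qed.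

Lemma value_neq0 (f : K) (c : F) : v f c -> c != 0 -> f != 0.
Proof.
by move=> vf; apply: contraNneq => f0; apply/eqP; apply: (value_fun vf); rewrite f0;
  apply: value0.
Qed.

Lemma value_exp (f : K) (c : F) n : v f c -> v (f ^+ n) (c ^+ n).
Proof.
by move=> vf; elim: n => [|n IHn]; rewrite ?expr0 ?exprS; [apply: value1 | apply: valueM].
Qed.

Lemma value_param_gt0 (k : int) : 0 < k -> v (pi ^ k) 0.
Proof.
case: k => // -[//|n] _; rewrite -exprnP -[X in v _ X](expr0n F n.+1).
exact: value_exp (value_param v).
Qed.

Lemma value_param_ge0 (k : int) : 0 <= k -> exists c, v (pi ^ k) c.
Proof.
by case: k => // n _; exists (0 ^+ n); rewrite -exprnP; apply/value_exp/value_param.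
Qed.

Lemma value_param_ge0P (k : int) (c : F) : v (pi ^ k) c -> 0 <= k.
Proof.
move=> vk; have [//|k_lt0] := leP 0 k.
have := valueM vk (value_param_gt0 (_ : 0 < - k)); rewrite oppr_gt0 => /(_ k_lt0).
rewrite -expfzDr ?param_neq0 // subrr mulr0 => v10.
by have /eqP := value_fun v10 value1; rewrite eq_sym oner_eq0.
Qed.

Definition mx_value p q (M : 'M[K]_(p, q)) (M0 : 'M[F]_(p, q)) : Prop :=
  forall i j, v (M i j) (M0 i j).

Definition mx_integral p q (M : 'M[K]_(p, q)) : Prop := exists M0, mx_value M M0.

Lemma mx_integralP p q (M : 'M[K]_(p, q)) :
  (forall i j, exists c, v (M i j) c) -> mx_integral M.
Proof.
move=> vM; exists (\matrix_(i, j) xget 0 [set c | v (M i j) c]%classic) => i j.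
by rewrite mxE; case: xgetP => [c -> //|]; have [c vc] := vM i j => /(_ c)/(_ vc).
Qed.

Lemma value_sum (I : Type) (r : seq I) (P : pred I) (f : I -> K) (g : I -> F) :
  (forall i, P i -> v (f i) (g i)) -> v (\sum_(i <- r | P i) f i) (\sum_(i <- r | P i) g i).
Proof. by move=> fg; apply: (big_ind2 v); [apply: value0 | move=> *; apply: valueD | ]. Qed.

Lemma value_prod (I : Type) (r : seq I) (P : pred I) (f : I -> K) (g : I -> F) :
  (forall i, P i -> v (f i) (g i)) ->
    v (\prod_(i <- r | P i) f i) (\prod_(i <- r | P i) g i).
Proof. by move=> fg; apply: (big_ind2 v); [apply: value1 | move=> *; apply: valueM | ]. Qed.

Section Closure.
Variables (p q r s : nat).
Implicit Types (M N : 'M[K]_(p, q)) (A B : 'M[F]_(p, q)).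

Lemma mx_valueM M A (N : 'M[K]_(q, r)) (B : 'M[F]_(q, r)) :
  mx_value M A -> mx_value N B -> mx_value (M *m N) (A *m B).
Proof. by move=> vM vN i j; rewrite !mxE; apply: value_sum => k _; apply: valueM. Qed.

Lemma mx_valueD M N A B : mx_value M A -> mx_value N B -> mx_value (M + N) (A + B).
Proof. by move=> vM vN i j; rewrite !mxE; apply: valueD. Qed.

Lemma mx_valueN M A : mx_value M A -> mx_value (- M) (- A).
Proof. by move=> vM i j; rewrite !mxE; apply: valueN. Qed.

Lemma mx_valueZ (a : K) (a0 : F) M A :
  v a a0 -> mx_value M A -> mx_value (a *: M) (a0 *: A).
Proof. by move=> va vM i j; rewrite !mxE; apply: valueM. Qed.

Lemma mx_value_tr M A : mx_value M A -> mx_value M^T A^T.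
Proof. by move=> vM i j; rewrite !mxE; apply: vM. Qed.

Lemma mx_value_sub (f : 'I_r -> 'I_p) (g : 'I_s -> 'I_q) M A :
  mx_value M A -> mx_value (mxsub f g M) (mxsub f g A).
Proof. by move=> vM i j; rewrite !mxE; apply: vM. Qed.

Lemma mx_value0 : mx_value (0 : 'M_(p, q)) 0.
Proof. by move=> i j; rewrite !mxE; apply: value0. Qed.

Lemma mx_value1 : mx_value (1%:M : 'M_p) 1%:M.
Proof. by move=> i j; rewrite !mxE; case: eqP => _; [apply: value1 | apply: value0]. Qed.

Lemma mx_value_fun M A B : mx_value M A -> mx_value M B -> A = B.
Proof. by move=> v1 v2; apply/matrixP => i j; apply: (value_fun (v1 i j)). Qed.

Lemma mx_value_lift A : exists M, mx_value M A.
Proof.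
have [C vC _] := valueC v; exists (map_mx C A) => i j.
by rewrite mxE; apply: vC.
Qed.

Lemma mx_value_row M A (N : 'M[K]_(p, r)) (B : 'M[F]_(p, r)) :
  mx_value M A -> mx_value N B -> mx_value (row_mx M N) (row_mx A B).
Proof. by move=> vM vN i j; rewrite !mxE; case: split. Qed.

Lemma mx_value_col M A (N : 'M[K]_(r, q)) (B : 'M[F]_(r, q)) :
  mx_value M A -> mx_value N B -> mx_value (col_mx M N) (col_mx A B).
Proof. by move=> vM vN i j; rewrite !mxE; case: split. Qed.

Lemma mx_integralM M (N : 'M[K]_(q, r)) :
  mx_integral M -> mx_integral N -> mx_integral (M *m N).
Proof. by move=> [A vM] [B vN]; exists (A *m B); apply: mx_valueM. Qed.

Lemma mx_integralD M N : mx_integral M -> mx_integral N -> mx_integral (M + N).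
Proof. by move=> [A vM] [B vN]; exists (A + B); apply: mx_valueD. Qed.

Lemma mx_integralN M : mx_integral M -> mx_integral (- M).
Proof. by move=> [A vM]; exists (- A); apply: mx_valueN. Qed.

Lemma mx_integralB M N : mx_integral M -> mx_integral N -> mx_integral (M - N).
Proof. by move=> iM iN; apply: mx_integralD => //; apply: mx_integralN. Qed.

Lemma mx_integralZ (a : K) (c : F) M : v a c -> mx_integral M -> mx_integral (a *: M).
Proof. by move=> va [A vM]; exists (c *: A); apply: mx_valueZ. Qed.

Lemma mx_integral_tr M : mx_integral M -> mx_integral M^T.
Proof. by move=> [A vM]; exists A^T; apply: mx_value_tr. Qed.

Lemma mx_integral_sub (f : 'I_r -> 'I_p) (g : 'I_s -> 'I_q) M :
  mx_integral M -> mx_integral (mxsub f g M).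
Proof. by move=> [A vM]; exists (mxsub f g A); apply: mx_value_sub. Qed.

Lemma mx_integral0 : mx_integral (0 : 'M_(p, q)).
Proof. by exists 0; apply: mx_value0. Qed.

Lemma mx_integral1 : mx_integral (1%:M : 'M_p).
Proof. by exists 1%:M; apply: mx_value1. Qed.

Lemma mx_integral_row M (N : 'M[K]_(p, r)) :
  mx_integral M -> mx_integral N -> mx_integral (row_mx M N).
Proof. by move=> [A vM] [B vN]; exists (row_mx A B); apply: mx_value_row. Qed.

Lemma mx_integral_col M (N : 'M[K]_(r, q)) :
  mx_integral M -> mx_integral N -> mx_integral (col_mx M N).
Proof. by move=> [A vM] [B vN]; exists (col_mx A B); apply: mx_value_col. Qed.

End Closure.

Lemma mx_value_det p (M : 'M[K]_p) (M0 : 'M[F]_p) : mx_value M M0 -> v (\det M) (\det M0).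
Proof.
move=> vM; apply: value_sum => s _; apply: valueM; last exact: value_prod.
by apply: value_exp; apply: valueN value1.
Qed.

(** The place is a local ring: a matrix that is invertible at the residue field
    has a determinant of nonzero value, and the adjugate has entries in the
    ring. *)
Lemma mx_value_unit p (M : 'M[K]_p) (M0 : 'M[F]_p) :
  mx_value M M0 -> M0 \in unitmx -> M \in unitmx /\ mx_integral (invmx M).
Proof.
rewrite !unitmxE !unitfE => vM M0u; have vdet := mx_value_det vM.
have det0 := value_neq0 vdet M0u; split=> //.
rewrite /invmx unitmxE unitfE det0; apply: mx_integralZ (valueV vdet M0u) _.
apply: mx_integralP => i j; rewrite mxE.
exists ((-1) ^+ (j + i) * \det (row' j (col' i M0))); apply: valueM.
  by apply: value_exp; apply: valueN value1.
by apply: mx_value_det => k l; rewrite !mxE.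
Qed.

Definition regular_mx p (U : 'M[K]_p) : Prop :=
  exists2 U0 : 'M[F]_p, U0 \in unitmx & mx_value U U0.

Lemma regular_mx_unit p (U : 'M[K]_p) : regular_mx U -> U \in unitmx.
Proof. by move=> [U0 U0u vU]; case: (mx_value_unit vU U0u). Qed.

Lemma regular_mx_integral p (U : 'M[K]_p) : regular_mx U -> mx_integral U.
Proof. by move=> [U0 _ vU]; exists U0. Qed.

Lemma regular_mx_inv p (U : 'M[K]_p) : regular_mx U -> mx_integral (invmx U).
Proof. by move=> [U0 U0u vU]; case: (mx_value_unit vU U0u). Qed.

Lemma regular_mxM p (U V : 'M[K]_p) : regular_mx U -> regular_mx V -> regular_mx (U *m V).
Proof.
move=> [U0 U0u vU] [V0 V0u vV]; exists (U0 *m V0); last exact: mx_valueM.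
by rewrite unitmx_mul U0u.
Qed.

Lemma regular_mx1 p : regular_mx (1%:M : 'M_p).
Proof. by exists 1%:M; rewrite ?unitmx1 //; apply: mx_value1. Qed.

Lemma regular_mx_tr p (U : 'M[K]_p) : regular_mx U -> regular_mx U^T.
Proof. by move=> [U0 uU vU]; exists U0^T; rewrite ?unitmx_tr //; apply: mx_value_tr. Qed.

Lemma regular_mx_tperm p (i j : 'I_p) : regular_mx (tperm_mx i j).
Proof.
exists (tperm_mx i j); first exact: unitmx_perm.
by move=> k l; rewrite !mxE; case: eqP => _; [apply: value1 | apply: value0].
Qed.

Lemma regular_mx_block p q (U : 'M[K]_p) (N : 'M[K]_(q, p)) (V : 'M[K]_q) :
  regular_mx U -> mx_integral N -> regular_mx V -> regular_mx (block_mx U 0 N V).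
Proof.
move=> [U0 U0u vU] [N0 vN] [V0 V0u vV]; exists (block_mx U0 0 N0 V0).
  by rewrite unitmxE det_lblock unitrM -!unitmxE U0u.
by apply: mx_value_col; apply: mx_value_row => //; apply: mx_value0.
Qed.

(** * The local Smith-McMillan form *)

Definition diag_powers p q (ds : seq int) : 'M[K]_(p, q) :=
  \matrix_(i, j) if (i == j :> nat) && (i < size ds)%N then pi ^ ds`_i else 0.

Definition local_form p q (M : 'M[K]_(p, q)) (ds : seq int) : Prop :=
  [/\ size ds = \rank M, sorted <=%R ds &
      exists (U : 'M[K]_p) (V : 'M[K]_q),
        [/\ regular_mx U, regular_mx V & U *m M *m V = diag_powers p q ds]].

Lemma diag_powers_cons p q d ds :
  diag_powers p.+1 q.+1 (d :: ds) = block_mx (pi ^ d)%:M 0 0 (diag_powers p q ds) :>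
    'M_(1 + p, 1 + q).
Proof.
apply/matrixP => i j; rewrite !mxE.
case: splitP => i' ->; rewrite !mxE; case: splitP => j' ->; rewrite !mxE ?ord1 //=.
Qed.

Lemma value_order (f : K) : exists k : int, f != 0 ->
  exists g c, [/\ f = pi ^ k * g, v g c & c != 0].
Proof.
have [-> | /(value_decomp v)[k [g [c hk]]]] := eqVneq f 0; first by exists 0.
by exists k => _; exists g, c.
Qed.

(** An entry of least order divides all the others within the ring, which is
    what makes elimination possible over a discrete valuation ring. *)
Lemma mx_pivot p q (M : 'M[K]_(p, q)) : M != 0 ->
  exists i j, M i j != 0 /\ forall k l, exists c, v (M k l / M i j) c.
Proof.
have [ord ordP] := choice value_order => nz_M.
have /existsP[[i0 j0] /= ij0] : [exists ij, M ij.1 ij.2 != 0].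
  apply: contraNT nz_M => /existsPn z_M; apply/eqP/matrixP => i j; rewrite mxE.
  by have /negPn/eqP := z_M (i, j).
pose P (ij : 'I_p * 'I_q) := M ij.1 ij.2 != 0.
case: (@arg_minP _ _ _ (i0, j0) P (fun ij => ord (M ij.1 ij.2)) ij0) =>
  -[i j] /= Pij min_ij.
exists i, j; split=> // k l; have [Mkl0 | Mkl0] := eqVneq (M k l) 0.
  by exists 0; rewrite Mkl0 mul0r; apply: value0.
have [g [c [-> vg c0]]] := ordP _ Pij; have [h [d [-> vh d0]]] := ordP _ Mkl0.
have := min_ij (k, l) Mkl0; rewrite /= -subr_ge0 => /value_param_ge0[e ve].
exists (e * (d / c)); rewrite invfM mulrACA invr_expz -expfzDr ?param_neq0 //.
by apply: valueM => //; apply: valueM => //; apply: valueV.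
Qed.

Lemma local_form0 p q : local_form (0 : 'M[K]_(p, q)) [::].
Proof.
split; rewrite ?mxrank0 //; exists 1%:M, 1%:M; split; try exact: regular_mx1.
by rewrite mulmx0 mul0mx; apply/matrixP => i j; rewrite !mxE andbF.
Qed.

Lemma local_form_regular p q (M : 'M[K]_(p, q)) U V ds :
  regular_mx U -> regular_mx V -> local_form (U *m M *m V) ds -> local_form M ds.
Proof.
move=> rU rV [sz srt [U' [V' [rU' rV' eqD]]]]; split=> //.
  by rewrite sz mxrankMfree ?row_free_unit ?regular_mx_unit // eqmxMfull ?row_full_unit
    ?regular_mx_unit.
exists (U' *m U), (V *m V'); split; try exact: regular_mxM.
by rewrite -eqD !mulmxA.
Qed.

(** The hypothesis that the pivot divides the remaining block passes to the
    diagonal form of that block, which makes the list of exponents increase. *)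
Lemma local_form_block p q (k : int) (N : 'M[K]_(p, q)) ds :
  mx_integral (pi ^ (- k) *: N) -> local_form N ds ->
  local_form (block_mx (pi ^ k)%:M 0 0 N : 'M_(1 + p, 1 + q)) (k :: ds).
Proof.
move=> iN [sz srt [U [V [rU rV eqD]]]].
have le_p : (size ds <= p)%N by rewrite sz rank_leq_row.
have le_q : (size ds <= q)%N by rewrite sz rank_leq_col.
have [D vD] : mx_integral (pi ^ (- k) *: diag_powers p q ds).
  rewrite -eqD scalemxAl scalemxAr.
  by apply: mx_integralM; [apply: mx_integralM|]; rewrite //; apply: regular_mx_integral.
have ge_k : all (>= k) ds.
  apply/(all_nthP 0) => i lt_i /=.
  have := vD (Ordinal (leq_trans lt_i le_p)) (Ordinal (leq_trans lt_i le_q)).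
  rewrite !mxE /= eqxx lt_i -expfzDr ?param_neq0 // addrC => /value_param_ge0P.
  by rewrite subr_ge0.
split; last 1 first.
- exists (block_mx 1%:M 0 0 U), (block_mx 1%:M 0 0 V).
  split; try by apply: regular_mx_block (regular_mx1 1) (mx_integral0 _ _) _.
  by rewrite !mulmx_block !(mulmx0, mul0mx, addr0, add0r, mul1mx, mulmx1) eqD
    diag_powers_cons.
- rewrite rank_diag_block_mx -sz /= -[in RHS]scalemx1 mxrank_scale_nz ?mxrank1 //.
  by rewrite expfz_neq0 ?param_neq0.
by rewrite /= path_min_sorted.
Qed.

(** Gaussian elimination with an entry of least order as pivot; only integral
    multipliers occur, so the transformations are regular. *)
Lemma local_form_exists p q (M : 'M[K]_(p, q)) : exists ds, local_form M ds.
Proof.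
elim: p q M => [|p IHp] [|q] M; have [->|nzM] := eqVneq M 0;
  try by exists [::]; apply: local_form0.
- by case/eqP: nzM; apply/matrixP => -[].
- by case/eqP: nzM; apply/matrixP => -[].
- by case/eqP: nzM; apply/matrixP => i -[].
have [i [j [Mij0 divM]]] := mx_pivot nzM.
pose M1 : 'M_(1 + p, 1 + q) := xrow i 0 (xcol j 0 M).
have M1E : M1 = tperm_mx i 0 *m M *m tperm_mx j 0 by rewrite /M1 xrowE xcolE mulmxA.
have [k [a [c [eq_ka va c0]]]] := value_decomp v Mij0.
have a0 := value_neq0 va c0.
have M100 : M1 0 0 = M i j by rewrite !mxE !tpermR.
have div1 k' l : exists d, v (M1 k' l / M i j) d by rewrite !mxE.
pose N := drsubmx M1 - (M i j)^-1 *: (dlsubmx M1 *m ursubmx M1).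
(* [U] clears the first column and reduces the pivot to a power of [pi]; [V] clears
   the first row, and is a transpose so as to be covered by [regular_mx_block]. *)
pose U := block_mx (a^-1)%:M 0 (- (M i j)^-1 *: dlsubmx M1) 1%:M : 'M_(1 + p).
pose V := (block_mx 1%:M 0 (- (M i j)^-1 *: (ursubmx M1)^T) 1%:M : 'M_(1 + q))^T.
have rU : regular_mx U.
  apply: regular_mx_block (regular_mx1 _).
    exists (c^-1)%:M; first by rewrite unitmxE det_scalar1 unitfE invr_eq0.
    move=> k' l; rewrite !ord1 !mxE eqxx !mulr1n; exact: valueV.
  apply: mx_integralP => k' l; rewrite !mxE mulNr.
  have [d vd] := div1 (rshift 1 k') (lshift q l); exists (- d); apply: valueN.
  by rewrite mulrC; move: vd; rewrite !mxE.
have rV : regular_mx V.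
  apply/regular_mx_tr/regular_mx_block; [exact: regular_mx1| | exact: regular_mx1].
  apply: mx_integralP => k' l; rewrite !mxE mulNr.
  have [d vd] := div1 (lshift p l) (rshift 1 k'); exists (- d); apply: valueN.
  by rewrite mulrC; move: vd; rewrite !mxE.
have ulE : ulsubmx M1 = (M i j)%:M.
  by apply/matrixP => k' l; rewrite !ord1 [RHS]mxE eqxx mulr1n -M100 2![LHS]mxE;
    congr (M1 _ _); apply: val_inj.
have eqB : U *m M1 *m V = block_mx (pi ^ k)%:M 0 0 N.
  rewrite -[M1 in LHS]submxK ulE /U /V tr_block_mx !trmx1 trmx0 linearZ /= trmxK
    !mulmx_block.
  rewrite !(mulmx0, mul0mx, addr0, add0r, mul1mx, mulmx1) -!scalemxAl -!scalemxAr.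
  have -> : - (M i j)^-1 *: (dlsubmx M1 *m (M i j)%:M) + dlsubmx M1 = 0.
    by rewrite mul_mx_scalar scalerA mulNr mulVf // scaleN1r addNr.
  rewrite mul0mx scaler0 add0r !scaleNr ![- _ + _]addrC -/N.
  have -> : (a^-1)%:M *m (M i j)%:M = (pi ^ k)%:M :> 'M_1.
    by rewrite -scalar_mxM eq_ka mulrCA mulVf ?mulr1.
  congr block_mx; rewrite !mul_scalar_mx scalerA eq_ka invfM mulrAC mulVf ?mul1r ?subrr //.
  by rewrite expfz_neq0 ?param_neq0.
have iN : mx_integral (pi ^ (- k) *: N).
  apply: mx_integralP => k' l.
  have [d1 vd1] := div1 (rshift 1 k') (rshift 1 l).
  have [d2 vd2] := div1 (rshift 1 k') (lshift q 0).
  have [d3 vd3] := div1 (lshift p 0) (rshift 1 l).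
  have va' : v (pi ^ (- k) * M i j) c
    by rewrite eq_ka mulrA -expfzDr ?param_neq0 // addNr mul1r.
  exists (c * (d1 - d2 * d3)); move: (valueM va' (valueD vd1 (valueN (valueM vd2 vd3)))).
  rewrite [N]lock !mxE -lock !mxE big_ord1 !mxE.
  congr (v _ _); rewrite -[LHS]mulrA; congr (_ * _).
  rewrite mulrBr mulrCA mulfV // mulr1 mulrACA [X in _ - X]mulrCA; congr (_ - _).
  by rewrite [M i j * _]mulrA mulfV // mul1r mulrC.
have [ds ldN] := IHp _ N.
exists (k :: ds).
apply: (local_form_regular (regular_mx_tperm i 0) (regular_mx_tperm j 0)).
rewrite -M1E; apply: (local_form_regular rU rV).
by rewrite eqB; apply: local_form_block.
Qed.

End LocalMatrices.

(** * Counting structural indices by witnesses *)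

Section Witnesses.
Variables (K F : fieldType) (v : place K F).
Local Notation pi := (param v).
Local Notation mx_value := (mx_value v).
Local Notation mx_integral := (mx_integral v).
Local Notation regular_mx := (regular_mx v).
Local Notation diag_powers := (diag_powers v).
Local Notation local_form := (local_form v).

Lemma regular_mx_invmx p (U : 'M[K]_p) : regular_mx U -> regular_mx (invmx U).
Proof.
move=> [U0 U0u vU]; have [Uu [W vW]] := mx_value_unit vU U0u; exists W => //.
have := mx_valueM vU vW; rewrite mulmxV // => vUW.
by have /mulmx1_unit[] := mx_value_fun vUW (@mx_value1 _ _ v p).
Qed.

(** At the residue field, the identity of size [r] factors through the rows in
    [I] alone; hence the bound on [r]. *)
Lemma inner_rank_bound r p (P : 'M[K]_(r, p)) (Q : 'M[K]_(p, r)) (I : {set 'I_p}) :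
  mx_value (P *m Q) 1%:M -> (forall a b i, i \notin I -> v (P a i * Q i b) 0) ->
  (r <= #|I|)%N.
Proof.
move=> vPQ v0; pose f (i : 'I_#|I|) := enum_val i.
have vI : mx_value (colsub f P *m rowsub f Q) 1%:M.
  move=> a b; pose S := \sum_(i | i \notin I) P a i * Q i b.
  have vS : v S 0 by have := value_sum (index_enum _) (v0 a b); rewrite big1_eq.
  have := valueD (vPQ a b) (valueN vS); rewrite oppr0 addr0; congr (v _ _).
  rewrite !mxE (bigID (fun i => i \in I)) /= -/S addrK big_enum_val.
  by apply: eq_bigr => i _; rewrite !mxE.
have [uI _] := mx_value_unit vI (unitmx1 _ _).
by rewrite -(mxrank_unit uI) mulmx_max_rank.
Qed.

(** A certificate for [r] indices that are at least [k]: the columns of [w] lie in the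
    image of [M], while the functionals [phi] send the image of integral vectors
    to multiples of [pi ^ k] and yet pair perfectly with [w] at the residue
    field. The preimage [u] of [w] may have poles; this, together with [w] and
    [phi] being integral, makes the notion blind to the poles of [M]. *)
Definition zero_witness p q (M : 'M[K]_(p, q)) (k : int) (r : nat) : Prop :=
  exists (phi : 'M[K]_(r, p)) (beta : 'M[K]_(r, q)) (u : 'M[K]_(q, r)) (w : 'M[K]_(p, r)),
    [/\ mx_integral phi /\ phi *m M = pi ^ k *: beta, mx_integral beta,
        mx_integral w /\ M *m u = w & mx_value (phi *m w) 1%:M].

(** A certificate for [r] indices that are at most [- k]: the rows of [phi *m M] have
    poles of order at most [k], and [psi] is the part of order exactly [k],
    which is onto at the residue field. Requiring [psi] to be integral, and not
    only [psi *m u], is what allows witnesses to be transported from one matrix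
    to another. *)
Definition pole_witness p q (M : 'M[K]_(p, q)) (k : int) (r : nat) : Prop :=
  exists (phi : 'M[K]_(r, p)) (psi : 'M[K]_(r, q)) (u : 'M[K]_(q, r)),
    [/\ mx_integral phi /\ phi *m M = pi ^ (- k) *: psi, mx_integral psi,
        mx_integral u & mx_value (psi *m u) 1%:M].

Lemma zero_witness_regular p q (M : 'M[K]_(p, q)) U V k r :
  regular_mx U -> regular_mx V -> zero_witness M k r -> zero_witness (U *m M *m V) k r.
Proof.
move=> rU rV [phi [beta [u [w [[iphi phiM] ibeta [iw Mu] vphi]]]]].
have uU := regular_mx_unit rU; have uV := regular_mx_unit rV.
exists (phi *m invmx U), (beta *m V), (invmx V *m u), (U *m w); split.
- split; first by apply: mx_integralM => //; apply: regular_mx_inv.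
  by rewrite !mulmxA mulmxKV // phiM scalemxAl.
- by apply: mx_integralM => //; apply: regular_mx_integral.
- split; first by apply: mx_integralM => //; apply: regular_mx_integral.
  by rewrite -!mulmxA mulKVmx // Mu.
- by rewrite mulmxA mulmxKV.
Qed.

Lemma pole_witness_regular p q (M : 'M[K]_(p, q)) U V k r :
  regular_mx U -> regular_mx V -> pole_witness M k r -> pole_witness (U *m M *m V) k r.
Proof.
move=> rU rV [phi [psi [u [[iphi phiM] ipsi iu vpsi]]]].
have uU := regular_mx_unit rU; have uV := regular_mx_unit rV.
exists (phi *m invmx U), (psi *m V), (invmx V *m u); split.
- split; first by apply: mx_integralM => //; apply: regular_mx_inv.
  by rewrite !mulmxA mulmxKV // phiM scalemxAl.
- by apply: mx_integralM => //; apply: regular_mx_integral.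
- by apply: mx_integralM => //; apply: regular_mx_inv.
- by rewrite mulmxA mulmxK.
Qed.

Section Diagonal.
Variables (p q : nat) (ds : seq int).
Hypotheses (le_p : (size ds <= p)%N) (le_q : (size ds <= q)%N).
Local Notation D := (diag_powers p q ds).

Lemma mul_diag_powers r (Q : 'M[K]_(q, r)) (i : 'I_p) (j : 'I_q) b :
  i = j :> nat -> (i < size ds)%N -> (D *m Q) i b = pi ^ ds`_i * Q j b.
Proof.
move=> eq_ij lt_i; rewrite mxE (bigD1 j) //= big1 ?addr0 ?mxE ?eq_ij ?eqxx -?eq_ij ?lt_i //.
move=> l ne_lj; rewrite mxE; case: eqP => [eq_il|]; last by rewrite mul0r.
by case/eqP: ne_lj; apply: val_inj; rewrite /= -eq_il.
Qed.

Lemma mul_diag_powers0 r (Q : 'M[K]_(q, r)) (i : 'I_p) b :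
  (size ds <= i)%N -> (D *m Q) i b = 0.
Proof. by move=> le_i; rewrite mxE big1 // => l _; rewrite mxE ltnNge le_i andbF mul0r. Qed.

Lemma mulr_diag_powers r (P : 'M[K]_(r, p)) (i : 'I_p) (j : 'I_q) a :
  i = j :> nat -> (i < size ds)%N -> (P *m D) a j = P a i * pi ^ ds`_i.
Proof.
move=> eq_ij lt_i; rewrite mxE (bigD1 i) //= big1 ?addr0 ?mxE ?eq_ij ?eqxx -?eq_ij ?lt_i //.
move=> l ne_li; rewrite mxE; case: eqP => [eq_lj|]; last by rewrite mulr0.
by case/eqP: ne_li; apply: val_inj; rewrite /= eq_lj.
Qed.

Lemma mulr_diag_powers0 r (P : 'M[K]_(r, p)) (j : 'I_q) a :
  (size ds <= j)%N -> (P *m D) a j = 0.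
Proof.
move=> le_j; rewrite mxE big1 // => l _; rewrite mxE.
by case: eqP => [->|]; rewrite ?[(j < _)%N]ltnNge ?le_j /= mulr0.
Qed.

Definition index_set n (P : pred int) : {set 'I_n} :=
  [set i : 'I_n | (i < size ds)%N && P ds`_i].

Lemma card_index_set n (P : pred int) : (size ds <= n)%N -> #|index_set n P| = count P ds.
Proof.
move=> le_n; rewrite -sum1_card -sum1_count (big_nth 0) big_mkord.
rewrite (big_ord_widen_cond n (fun i => P ds`_i) (fun=> 1%N)) //.
by apply: eq_bigl => i; rewrite inE andbC.
Qed.

(** For a diagonal matrix, [phi] vanishes at the residue field on the rows with
    an exponent less than [k], and [w] vanishes on the zero rows, so that the
    pairing of [phi] with [w] only sees the rows with an exponent at least
    [k]. *)
Lemma zero_witness_diag_le k r : zero_witness D k r -> (r <= count (>= k) ds)%N.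
Proof.
move=> [phi [beta [u [w [[[phi0 vphi] phiD] [beta0 vbeta] [[w0 vw] Du] vphiw]]]]].
rewrite -(card_index_set _ le_p); apply: inner_rank_bound vphiw _ => a b i.
rewrite inE; case: ltnP => [lt_i | le_i _] /=; last first.
  by rewrite -Du mul_diag_powers0 // mulr0; apply: value0.
rewrite -ltNge => lt_k; pose j := Ordinal (leq_trans lt_i le_q).
have := mulr_diag_powers phi a (erefl : i = j :> nat) lt_i; rewrite phiD mxE => eq_phi.
have -> : phi a i = pi ^ (k - ds`_i) * beta a j.
  by rewrite expfzDr ?param_neq0 // mulrAC eq_phi -mulrA -expfzDr ?param_neq0 // subrr
    mulr1.
rewrite -(mul0r (w0 i b)) -(mul0r (beta0 a j)).
by do 2?apply: valueM => //; apply: value_param_gt0; rewrite subr_gt0.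
Qed.

(** For a diagonal matrix, [psi] vanishes at the residue field on the columns
    with an exponent greater than [- k], and vanishes on the zero columns. *)
Lemma pole_witness_diag_le k r : pole_witness D k r -> (r <= count (<= - k) ds)%N.
Proof.
move=> [phi [psi [u [[[phi0 vphi] phiD] [psi0 vpsi] [u0 vu] vpsiu]]]].
rewrite -(card_index_set _ le_q); apply: inner_rank_bound vpsiu _ => a b j.
have psiE : psi = pi ^ k *: (phi *m D).
  by rewrite phiD scalerA -expfzDr ?param_neq0 // subrr scale1r.
rewrite inE; case: ltnP => [lt_j | le_j _] /=; last first.
  by rewrite psiE mxE mulr_diag_powers0 // mulr0 mul0r; apply: value0.
rewrite -ltNge => lt_k; pose i := Ordinal (leq_trans lt_j le_p).
have eq_phi := mulr_diag_powers phi a (erefl : i = j :> nat) lt_j.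
rewrite psiE mxE eq_phi mulrCA -expfzDr ?param_neq0 //.
rewrite -(mul0r (u0 j b)) -(mulr0 (phi0 a i)).
by do 2?apply: valueM => //; apply: value_param_gt0; rewrite -ltrBlDl sub0r.
Qed.

Section Selection.
Variables (P : pred int).
Let I := index_set p P.
Let f (a : 'I_#|I|) : 'I_p := enum_val a.

Lemma selection_lt a : (f a < size ds)%N.
Proof. by have := enum_valP a; rewrite inE => /andP[]. Qed.

Lemma selection_pred a : P ds`_(f a).
Proof. by have := enum_valP a; rewrite inE => /andP[]. Qed.

Let g (a : 'I_#|I|) : 'I_q := Ordinal (leq_trans (selection_lt a) le_q).

Lemma selection_inj : injective f. Proof. exact: enum_val_inj. Qed.
Lemma selectionr_inj : injective g.
Proof. by move=> a b [] /val_inj/selection_inj. Qed.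

Lemma selection_mul (n : nat) (h : 'I_#|I| -> 'I_n) : injective h ->
  rowsub h 1%:M *m colsub h 1%:M = 1%:M :> 'M[K]_#|I|.
Proof.
move=> inj_h; rewrite -mxsub_mul mulmx1.
by apply/matrixP => a b; rewrite !mxE (inj_eq inj_h).
Qed.

Lemma rowsub_diag_powers :
  rowsub f D = diag_mx (\row_a pi ^ ds`_(f a)) *m rowsub g 1%:M.
Proof.
apply/matrixP => a j; rewrite mul_diag_mx !mxE selection_lt andbT -val_eqE /=.
by case: eqP => _; rewrite ?mulr1 ?mulr0.
Qed.

Lemma diag_powers_colsub :
  D *m colsub g 1%:M = colsub f 1%:M *m diag_mx (\row_a pi ^ ds`_(f a)).
Proof.
rewrite mulmx_colsub mulmx1; apply/matrixP => i b; rewrite mul_mx_diag !mxE /=.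
rewrite -val_eqE /=; case: eqP => [->|_] /=; last by rewrite mul0r.
by rewrite selection_lt mul1r.
Qed.

Lemma integral_selection (n : nat) (h : 'I_#|I| -> 'I_n) :
  mx_integral (rowsub h 1%:M) /\ mx_integral (colsub h 1%:M).
Proof. by split; apply/mx_integral_sub/mx_integral1. Qed.

Lemma integral_diag_mx n (d : 'I_n -> int) : (forall a, 0 <= d a) ->
  mx_integral (diag_mx (\row_a pi ^ d a)).
Proof.
move=> d_ge0; apply: mx_integralP => a b; rewrite !mxE; case: eqP => _.
  exact: value_param_ge0.
by exists 0; rewrite mulr0n; apply: value0.
Qed.

Lemma zero_witness_selection k : (forall d, P d -> k <= d) -> zero_witness D k #|I|.
Proof.
move=> Pk; have [ifr ifc] := integral_selection f; have [igr igc] := integral_selection g.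
exists (rowsub f 1%:M), (diag_mx (\row_a pi ^ (ds`_(f a) - k)) *m rowsub g 1%:M),
  (colsub g 1%:M *m diag_mx (\row_a pi ^ (- ds`_(f a)))), (colsub f 1%:M).
split.
- split=> //; rewrite mul_rowsub_mx mul1mx rowsub_diag_powers scalemxAl; congr (_ *m _).
  rewrite -linearZ /=; congr diag_mx; apply/rowP => a; rewrite !mxE -expfzDr ?param_neq0 //.
  by rewrite addrC subrK.
- by apply: mx_integralM => //; apply: integral_diag_mx => a;
  rewrite subr_ge0 Pk ?selection_pred.
- split=> //; rewrite mulmxA diag_powers_colsub -mulmxA mulmx_diag -[RHS]mulmx1;
  congr (_ *m _).
  rewrite -diag_const_mx; congr diag_mx; apply/rowP => a.
  by rewrite !mxE -expfzDr ?param_neq0 // subrr.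
- by rewrite selection_mul; [apply: mx_value1 | apply: selection_inj].
Qed.

Lemma pole_witness_selection k : (forall d, P d -> d <= - k) -> pole_witness D k #|I|.
Proof.
move=> Pk; have [ifr ifc] := integral_selection f; have [igr igc] := integral_selection g.
exists (diag_mx (\row_a pi ^ (- k - ds`_(f a))) *m rowsub f 1%:M), (rowsub g 1%:M),
  (colsub g 1%:M).
split=> //.
- split.
    by apply: mx_integralM => //; apply: integral_diag_mx => a;
      rewrite subr_ge0 Pk ?selection_pred.
  rewrite -mulmxA mul_rowsub_mx mul1mx rowsub_diag_powers mulmxA mulmx_diag -mul_scalar_mx.
  congr (_ *m _); rewrite -diag_const_mx; congr diag_mx; apply/rowP => a.
  by rewrite !mxE -expfzDr ?param_neq0 // subrK.
- by rewrite selection_mul; [apply: mx_value1 | apply: selectionr_inj].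
Qed.

End Selection.
End Diagonal.

Lemma local_form_size p q (M : 'M[K]_(p, q)) ds :
  local_form M ds -> (size ds <= p)%N /\ (size ds <= q)%N.
Proof. by case=> -> _ _; rewrite rank_leq_row rank_leq_col. Qed.

Lemma local_formE p q (M : 'M[K]_(p, q)) ds : local_form M ds ->
  exists U V U' V', [/\ regular_mx U /\ regular_mx V, regular_mx U' /\ regular_mx V',
    U *m M *m V = diag_powers p q ds & M = U' *m diag_powers p q ds *m V'].
Proof.
case=> _ _ [U [V [rU rV eqD]]]; exists U, V, (invmx U), (invmx V).
split; rewrite //; first by split; apply: regular_mx_invmx.
by rewrite -eqD !mulmxA mulVmx ?(regular_mx_unit rU) // mul1mx mulmxK ?(regular_mx_unit rV).
Qed.

Lemma zero_witnessP p q (M : 'M[K]_(p, q)) ds k : local_form M ds ->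
  zero_witness M k (count (>= k) ds) /\ forall r, zero_witness M k r ->
    (r <= count (>= k) ds)%N.
Proof.
move=> ldM; have [le_p le_q] := local_form_size ldM.
have [U [V [U' [V' [[rU rV] [rU' rV'] eqD eqM]]]]] := local_formE ldM; split=> [|r].
  rewrite -(card_index_set _ le_p) eqM; apply: zero_witness_regular => //.
  exact: zero_witness_selection.
by move=> /(zero_witness_regular rU rV); rewrite eqD; apply: zero_witness_diag_le.
Qed.

Lemma pole_witnessP p q (M : 'M[K]_(p, q)) ds k : local_form M ds ->
  pole_witness M k (count (<= - k) ds) /\ forall r, pole_witness M k r ->
    (r <= count (<= - k) ds)%N.
Proof.
move=> ldM; have [le_p le_q] := local_form_size ldM.
have [U [V [U' [V' [[rU rV] [rU' rV'] eqD eqM]]]]] := local_formE ldM; split=> [|r].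
  rewrite -(card_index_set _ le_p) eqM; apply: pole_witness_regular => //.
  exact: pole_witness_selection.
by move=> /(pole_witness_regular rU rV); rewrite eqD; apply: pole_witness_diag_le.
Qed.

End Witnesses.

Lemma sorted_count_eq (s t : seq int) :
  sorted <=%R s -> sorted <=%R t -> (forall k : int, count (>= k) s = count (>= k) t) ->
    s = t.
Proof.
move=> srt_s srt_t eq_st; apply: (sorted_eq le_trans le_anti) => //.
have split_count (u : seq int) (k : int) :
    count (>= k) u = (count_mem k u + count (>= (k + 1)%R) u)%N.
  rewrite -count_predUI [X in (_ = _ + X)%N](_ : _ = 0%N) ?addn0.
    by apply: eq_count => d /=; rewrite lezD1 le_eqVlt eq_sym.
  rewrite -[RHS](count_pred0 u); apply: eq_count => d /=.
  by rewrite lezD1; apply/andP => -[/eqP->]; rewrite ltxx.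
apply/allP => k _; apply/eqP/(@addIn (count (>= (k + 1)) s)).
by rewrite -split_count [in RHS]eq_st -split_count.
Qed.

(** * Structural indices and zeros *)

Section Uniqueness.
Variables (K F : fieldType) (v : place K F).
Local Notation local_form := (local_form v).

Lemma local_form_uniq p q (M : 'M[K]_(p, q)) ds ds' :
  local_form M ds -> local_form M ds' -> ds = ds'.
Proof.
move=> ld ld'; have [_ srt _] := ld; have [_ srt' _] := ld'.
apply: sorted_count_eq => // k; apply/eqP; rewrite eqn_leq.
have [w le_w] := zero_witnessP k ld; have [w' le_w'] := zero_witnessP k ld'.
by rewrite le_w' // le_w.
Qed.

Lemma local_form_tr p q (M : 'M[K]_(p, q)) ds : local_form M ds -> local_form M^T ds.
Proof.
move=> [sz srt [U [V [rU rV eqD]]]]; split; rewrite ?mxrank_tr //.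
exists V^T, U^T; split; try exact: regular_mx_tr.
rewrite -mulmxA -!trmx_mul eqD; apply/matrixP => i j; rewrite !mxE eq_sym.
by case: eqP => // ->.
Qed.

(** In the local form, a matrix of full row rank without positive exponents is
    [diag (pi ^ d_i)] followed by zero columns, and [diag (pi ^ (- d_i))] is
    integral. *)
Lemma local_form_no_zeros p q (M : 'M[K]_(p, q)) ds :
  local_form M ds -> all (<= 0) ds -> row_free M ->
  exists X, mx_integral v X /\ M *m X = 1%:M.
Proof.
move=> ld ds_le0 /eqP freeM; have [le_p le_q] := local_form_size ld.
have [sz _ [U [V [rU rV eqD]]]] := ld; rewrite freeM in sz.
pose E : 'M[K]_(q, p) := \matrix_(i, j) if i == j :> nat then param v ^ (- ds`_j) else 0.
have DE : diag_powers v p q ds *m E = 1%:M.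
  apply/matrixP => i j; have lt_i : (i < size ds)%N by rewrite sz.
  pose i' : 'I_q := Ordinal (leq_trans lt_i le_q).
  rewrite (@mul_diag_powers _ _ _ _ _ _ _ _ i i') // !mxE -val_eqE /=.
  by case: eqP => [->|_]; rewrite ?mulr0 // -expfzDr ?param_neq0 // subrr.
exists (V *m E *m U); split; last first.
  have -> : M *m (V *m E *m U) = invmx U *m (U *m M *m V *m E) *m U.
    by rewrite !mulmxA mulVmx ?(regular_mx_unit rU) ?mul1mx.
  by rewrite eqD DE mulmx1 mulVmx ?(regular_mx_unit rU).
do 2?apply: mx_integralM; try exact: regular_mx_integral.
apply: mx_integralP => i j; rewrite mxE; case: eqP => _; last by exists 0; apply: value0.
apply: value_param_ge0; rewrite oppr_ge0.
by apply: (allP ds_le0); rewrite mem_nth // sz.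
Qed.

(** With an integral right inverse [X], a witness for an index at least [1]
    would satisfy [phi = pi *: (beta *m X)], hence [phi] would have value [0]
    and could not pair with the integral [w]. *)
Lemma local_form_right_inverse p q (M : 'M[K]_(p, q)) ds X :
  local_form M ds -> mx_integral v X -> M *m X = 1%:M -> all (<= 0) ds.
Proof.
move=> ld iX MX; rewrite -[all _ _]negbK -has_predC; apply/negP => has_pos.
have [[phi [beta [u [w [[iphi phiM] ibeta [iw Mu] vphiw]]]]] _] := zero_witnessP 1 ld.
have {}has_pos : (0 < count (>= (1%R : int)) ds)%N.
  rewrite -has_count; apply: sub_has has_pos => d /=.
  by rewrite -ltNge -gtz0_ge1.
have phiE : phi = param v ^ 1 *: (beta *m X)
  by rewrite -[phi]mulmx1 -MX mulmxA phiM scalemxAl.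
have [B vB] := ibeta; have [Y vX] := iX; have [W vW] := iw.
have := vphiw (Ordinal has_pos) (Ordinal has_pos).
have := mx_valueM (mx_valueZ (value_param_gt0 v (ltr01 : 0 < 1 :> int)) (mx_valueM vB vX))
  vW.
rewrite -phiE scale0r mul0mx =>
  /(_ (Ordinal has_pos) (Ordinal has_pos)) v0 /(value_fun v0) /eqP.
by rewrite !mxE eqxx eq_sym oner_eq0.
Qed.

End Uniqueness.

Lemma rowsub_free_exists (E : fieldType) p q (M : 'M[E]_(p, q)) r : \rank M = r ->
  exists f : 'I_r -> 'I_p, row_free (rowsub f M).
Proof. by move=> <-; exists (maxrankfun M); apply: maxrowsub_free. Qed.

Lemma normal_rankE (F : fieldType) p q (M : 'M[ratfun F]_(p, q)) : normal_rank M = \rank M.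
Proof.
apply/eqP; rewrite eqn_leq /normal_rank; apply/andP; split.
  apply/bigmax_leqP => k /existsP[f /existsP[g det0]].
  have : row_free (mxsub f g M) by rewrite row_free_unit unitmxE unitfE.
  rewrite /row_free => /eqP <-.
  have -> : mxsub f g M = rowsub f 1%:M *m (M *m colsub g 1%:M).
    by rewrite mulmxA -rowsubE -mxsub_mul mulmx1.
  by rewrite (leq_trans (mxrankM_maxr _ _)) // mxrankM_maxl.
have [f freeN] := rowsub_free_exists (erefl (\rank M)).
have rNT : \rank (rowsub f M)^T = \rank M by rewrite mxrank_tr (eqP freeN).
have [g freeNT] := rowsub_free_exists rNT.
have le_r : (\rank M < (minn p q).+1)%N by rewrite ltnS leq_min rank_leq_row rank_leq_col.
apply: (bigop.bigmax_sup (Ordinal le_r)) => //=; apply/existsP; exists [ffun i => f i].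
apply/existsP; exists [ffun i => g i].
rewrite -det_tr -unitfE -unitmxE -row_free_unit; congr row_free: freeNT.
by apply/matrixP => i j; rewrite !mxE !ffunE.
Qed.

Section PointStructure.
Variables (F : fieldType) (x : point F).
Local Notation pp := (point_place x).

Lemma structural_indicesP p q (M : 'M[ratfun F]_(p, q)) ds :
  local_form pp M ds <-> structural_indices M x = ds.
Proof.
have siE (N : 'M[ratfun F]_(p, q)) es : is_structural_indices N x es <-> local_form pp N es.
  by rewrite /is_structural_indices normal_rankE.
have [es ldM] := local_form_exists pp M.
have eq_si : structural_indices M x = es.
  rewrite /structural_indices; case: xgetP => [_ -> /siE/local_form_uniq|]; first exact.
  by move/(_ es)/(_ ((siE _ _).2 ldM)).
by rewrite eq_si; split=> [/(local_form_uniq ldM)|<-].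
Qed.

Lemma structural_indices_form p q (M : 'M[ratfun F]_(p, q)) :
  local_form pp M (structural_indices M x).
Proof. exact/structural_indicesP. Qed.

Lemma structural_indices_tr p q (M : 'M[ratfun F]_(p, q)) :
  structural_indices M^T x = structural_indices M x.
Proof. exact/structural_indicesP/local_form_tr/structural_indices_form. Qed.

Lemma sorted_positive_eq (s t : seq int) :
    sorted <=%R s -> sorted <=%R t -> all (> 0) s -> all (> 0) t ->
    (forall k : int, 0 < k -> count (>= k) s = count (>= k) t) -> s = t.
Proof.
move=> srt_s srt_t s_gt0 t_gt0 eq_st; apply: sorted_count_eq => // k.
have [k_le0 | /eq_st//] := leP k 0.
have low u : all (> 0) u -> count (>= k) u = count (>= (1%R : int)) u.
  move=> /allP u_gt0; apply: eq_in_count => d /u_gt0; rewrite /= gtz0_ge1 => d_ge1.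
  by rewrite d_ge1 (le_trans k_le0) // (le_trans _ d_ge1).
by rewrite !low // eq_st.
Qed.

Lemma zero_structureP p q (M : 'M[ratfun F]_(p, q)) :
  [/\ sorted <=%R (zero_structure M x), all (> 0) (zero_structure M x) &
      forall k : int, 0 < k ->
      zero_witness pp M k (count (>= k) (zero_structure M x)) /\
      forall r, zero_witness pp M k r -> (r <= count (>= k) (zero_structure M x))%N].
Proof.
have ld := structural_indices_form M; have [_ srt _] := ld.
rewrite /zero_structure; split; first exact: sorted_filter le_trans _ _ srt.
  exact: filter_all.
move=> k k_gt0; rewrite count_filter.
rewrite (@eq_count _ _ (>= k)); first exact: zero_witnessP.
by move=> d /=; apply: andb_idr; apply: lt_le_trans.
Qed.

Lemma polar_structureP p q (M : 'M[ratfun F]_(p, q)) :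
  [/\ sorted <=%R (polar_structure M x), all (> 0) (polar_structure M x) &
      forall k : int, 0 < k ->
      pole_witness pp M k (count (>= k) (polar_structure M x)) /\
      forall r, pole_witness pp M k r -> (r <= count (>= k) (polar_structure M x))%N].
Proof.
have ld := structural_indices_form M; have [_ srt _] := ld.
set ds := structural_indices M x in ld srt.
have eq_neg : [seq `|d| | d <- ds & d < 0] = [seq - d | d <- ds & d < 0].
  by apply/eq_in_map => d; rewrite mem_filter => /andP[d_lt0 _]; rewrite ltr0_norm.
rewrite /polar_structure -/ds eq_neg; split.
- rewrite rev_sorted sorted_map; apply: sub_sorted (sorted_filter le_trans _ srt).
  by move=> d e /=; rewrite lerN2.
- by rewrite all_rev all_map all_filter; apply/allP => d _ /=; rewrite oppr_gt0 implybb.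
move=> k k_gt0; rewrite count_rev count_map count_filter.
rewrite (@eq_count _ _ (<= - k)); first exact: pole_witnessP.
move=> d /=; rewrite lerNr; apply: andb_idr => /le_lt_trans-> //.
by rewrite oppr_lt0.
Qed.

End PointStructure.

Lemma zero_structure_tr (F : fieldType) p q (M : 'M[ratfun F]_(p, q)) x :
  zero_structure M^T x = zero_structure M x.
Proof. by rewrite /zero_structure structural_indices_tr. Qed.

Lemma zero_structure_eq (F : fieldType) p q p' q' (M : 'M[ratfun F]_(p, q))
    (N : 'M[ratfun F]_(p', q')) x :
  (forall k r, 0 < k -> zero_witness (point_place x) M k r <->
    zero_witness (point_place x) N k r) ->
  zero_structure M x = zero_structure N x.
Proof.
move=> MN; have [? ? wM] := zero_structureP x M; have [? ? wN] := zero_structureP x N.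
apply: sorted_positive_eq => // k k_gt0; apply/eqP; rewrite eqn_leq.
have [zM leM] := wM _ k_gt0; have [zN leN] := wN _ k_gt0.
by rewrite leN ?leM //; apply/(MN _ _ k_gt0).
Qed.

Lemma polar_zero_structure_eq (F : fieldType) p q p' q' (M : 'M[ratfun F]_(p, q))
    (N : 'M[ratfun F]_(p', q')) x :
  (forall k r, 0 < k -> pole_witness (point_place x) M k r <->
    zero_witness (point_place x) N k r) ->
  polar_structure M x = zero_structure N x.
Proof.
move=> MN; have [? ? wM] := polar_structureP x M; have [? ? wN] := zero_structureP x N.
apply: sorted_positive_eq => // k k_gt0; apply/eqP; rewrite eqn_leq.
have [zM leM] := wM _ k_gt0; have [zN leN] := wN _ k_gt0.
by rewrite leN ?leM //; apply/(MN _ _ k_gt0).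
Qed.

Lemma has_no_zeros_tr (F : fieldType) p q (M : 'M[ratfun F]_(p, q)) :
  has_no_zeros M^T <-> has_no_zeros M.
Proof. by split=> nz x; have := nz x; rewrite zero_structure_tr. Qed.

(** For a matrix of full row rank, the absence of zeros becomes an equation,
    which is the form in which strong irreducibility is used. *)
Lemma has_no_zerosP (F : fieldType) p q (M : 'M[ratfun F]_(p, q)) : row_free M ->
  has_no_zeros M <->
  forall x, exists X, mx_integral (point_place x) X /\ M *m X = 1%:M.
Proof.
have noneE x : zero_structure M x = [::] <-> all (<= 0) (structural_indices M x).
  rewrite /zero_structure; split=> [/eqP|le0].
    rewrite -size_eq0 size_filter -leqn0 leqNgt -has_count => /hasPn le0.
    by apply/allP => d /le0; rewrite /= -leNgt.
  by apply/eqP; rewrite -size_eq0 size_filter -leqn0 leqNgt -has_count;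
    apply/hasPn => d /(allP le0); rewrite /= -leNgt.
move=> freeM; split=> [nz x | inv x].
  exact: local_form_no_zeros (structural_indices_form x M) ((noneE x).1 (nz x)) freeM.
have [X [iX MX]] := inv x; apply/noneE.
exact: local_form_right_inverse (structural_indices_form x M) iX MX.
Qed.

(** * Coprime realizations *)

(** The relations that tie a system matrix [L] to its transfer function [T]. For
    a linear system pencil with blocks [A], [- B], [C], [D], they hold with
    [G = (0; - 1)], [H = (0, 1)], [Z = (A^-1 B; 1)] and [W = (- C A^-1, 1)]. The
    set of these relations is stable under transposition, which exchanges the
    roles of [G] and [H], and of [Z] and [W]. *)
Definition realizes (K : fieldType) p q m n (L : 'M[K]_(p, q)) (T : 'M[K]_(m, n))
    (G : 'M[K]_(p, m)) (H : 'M[K]_(n, q)) (Z : 'M[K]_(q, n)) (W : 'M[K]_(m, p)) : Prop :=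
  [/\ L *m Z = - (G *m T), H *m Z = 1%:M, W *m L = T *m H & W *m G = - 1%:M].

(** Bezout identities: [L] and [G] generate all integral columns, but [L] may
    have poles. *)
Definition left_coprime (K F : fieldType) (v : place K F) p q m
    (L : 'M[K]_(p, q)) (G : 'M[K]_(p, m)) : Prop :=
  exists (X1 : 'M[K]_(q, p)) (X2 : 'M[K]_(m, p)),
    [/\ mx_integral v X1, mx_integral v X2 & L *m X1 + G *m X2 = 1%:M].

Definition right_coprime (K F : fieldType) (v : place K F) p q n
    (L : 'M[K]_(p, q)) (H : 'M[K]_(n, q)) : Prop :=
  exists (Y1 : 'M[K]_(q, p)) (Y2 : 'M[K]_(q, n)),
    [/\ mx_integral v Y1, mx_integral v Y2 & Y1 *m L + Y2 *m H = 1%:M].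

Lemma realizes_tr (K : fieldType) p q m n (L : 'M[K]_(p, q)) (T : 'M[K]_(m, n)) G H Z W :
  realizes L T G H Z W -> realizes L^T T^T (- H^T) (- G^T) W^T Z^T.
Proof.
move=> [LZ HZ WL WG]; split; rewrite ?(mulmxN, mulNmx, opprK) -!trmx_mul.
- by rewrite WL.
- by rewrite WG linearN /= trmx1 opprK.
- by rewrite LZ linearN.
- by rewrite HZ trmx1.
Qed.

Lemma right_coprime_tr (K F : fieldType) (v : place K F) p q m (L : 'M[K]_(p, q))
    (G : 'M[K]_(p, m)) :
  left_coprime v L G -> right_coprime v L^T (- G^T).
Proof.
move=> [X1 [X2 [iX1 iX2 eq1]]]; exists X1^T, (- X2^T).
split; [exact: mx_integral_tr | exact/mx_integralN/mx_integral_tr|].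
by rewrite mulNmx mulmxN opprK -!trmx_mul -linearD /= eq1 trmx1.
Qed.

(** When [Y1], [Y2] and [G] are integral, all the poles of [Z] come from [T]. *)
Lemma coprime_decomp (K : fieldType) p q m n (L : 'M[K]_(p, q))
    (T : 'M[K]_(m, n)) G H Z W : realizes L T G H Z W -> forall Y1 Y2,
  Y1 *m L + Y2 *m H = 1%:M -> Z = Y2 - Y1 *m G *m T.
Proof.
move=> [LZ HZ _ _] Y1 Y2 eq1.
by rewrite -[Z]mul1mx -eq1 mulmxDl -!mulmxA LZ HZ mulmx1 mulmxN addrC.
Qed.

Section Local.
Variables (K F : fieldType) (v : place K F).
Local Notation pi := (param v).
Local Notation mx_value := (mx_value v).
Local Notation mx_integral := (mx_integral v).

Lemma mx_value_mod p q (M N : 'M[K]_(p, q)) A (k : int) : 0 < k ->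
  mx_integral N -> mx_value M A -> mx_value (M + pi ^ k *: N) A.
Proof.
move=> k_gt0 [B vN] vM; rewrite -[A]addr0 -(scale0r B).
by apply: mx_valueD => //; apply: mx_valueZ => //; apply: value_param_gt0.
Qed.

Lemma mx_integral_paramZ p q (M : 'M[K]_(p, q)) (k : int) : 0 < k ->
  mx_integral M -> mx_integral (pi ^ k *: M).
Proof. by move=> k_gt0; apply: mx_integralZ (value_param_gt0 v k_gt0). Qed.

Section ZeroWitness.
Variables (p q m n : nat) (L : 'M[K]_(p, q)) (T : 'M[K]_(m, n)).
Variables (G : 'M[K]_(p, m)) (H : 'M[K]_(n, q)) (Z : 'M[K]_(q, n)) (W : 'M[K]_(m, p)).
Hypotheses (real : realizes L T G H Z W) (iG : mx_integral G) (iH : mx_integral H).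
Hypotheses (lc : left_coprime v L G) (rc : right_coprime v L H).

(** The functional [phi *m W] on the values of [L] extends [phi]: it sends the
    image of [L] into that of [T] because [W *m L = T *m H]. It is integral
    because [W = T *m H *m X1 - X2] and [phi *m T] is integral. *)
Lemma zero_witness_realization k r : 0 < k -> zero_witness v T k r -> zero_witness v L k r.
Proof.
have [LZ HZ WL WG] := real; have [X1 [X2 [iX1 iX2 eqX]]] := lc.
move=> k_gt0 [phi [beta [u [w [[iphi phiT] ibeta [iw Tu] vphiw]]]]].
have WE : W = T *m H *m X1 - X2.
  by rewrite -[W]mulmx1 -eqX mulmxDr !mulmxA WL WG mulNmx mul1mx.
exists (phi *m W), (beta *m H), (Z *m u), (- (G *m w)); split.
- split; last by rewrite -mulmxA WL mulmxA phiT scalemxAl.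
  rewrite WE mulmxBr !mulmxA phiT -!scalemxAl; apply: mx_integralB;
    last exact: mx_integralM.
  by apply: mx_integral_paramZ => //; do 2?apply: mx_integralM.
- exact: mx_integralM.
- split; first by apply/mx_integralN/mx_integralM.
  by rewrite mulmxA LZ mulNmx -mulmxA Tu.
- by rewrite mulmxN mulmxA -[phi *m W *m G]mulmxA WG mulmxN mulmx1 mulNmx opprK.
Qed.

(** Modulo the image of [L] applied to integral vectors, [w] may be replaced by
    [w - L *m X1 *m w = G *m X2 *m w], which comes from the value [- X2 *m w] of
    [T]. Likewise [- phi *m G] is corrected by a multiple of [pi ^ k], so that its
    composite with [T] becomes the integral [pi ^ k *: (beta *m Y2)] instead of
    [pi ^ k *: (beta *m Z)]. Since [k > 0], these changes are invisible at the
    residue field. *)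
Lemma zero_witness_transfer k r : 0 < k -> zero_witness v L k r -> zero_witness v T k r.
Proof.
have [LZ HZ WL WG] := real; have [X1 [X2 [iX1 iX2 eqX]]] := lc.
have [Y1 [Y2 [iY1 iY2 eqY]]] := rc.
move=> k_gt0 [phi [beta [u [w [[iphi phiL] ibeta [iw Lu] vphiw]]]]].
have ZE := coprime_decomp real eqY.
have GX2 : G *m X2 = 1%:M - L *m X1 by rewrite -eqX addrC addKr.
have THX1 : T *m H *m X1 = W + X2.
  by rewrite -WL -[W in RHS]mulmx1 -eqX mulmxDr !mulmxA WG mulNmx mul1mx subrK.
exists (pi ^ k *: (beta *m Y1 *m G) - phi *m G), (beta *m Y2), (H *m (u - X1 *m w)),
  (- (X2 *m w)).
split.
- split.
    apply: mx_integralB; last exact: mx_integralM.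
    by apply: mx_integral_paramZ => //; do 2?apply: mx_integralM.
  have -> : Y2 = Z + Y1 *m G *m T by rewrite ZE subrK.
  have eqZ : pi ^ k *: (beta *m Z) = - (phi *m G *m T).
    by rewrite scalemxAl -phiL -!mulmxA LZ mulmxN.
  by rewrite mulmxBl mulmxDr scalerDr eqZ -scalemxAl !mulmxA addrC.
- exact: mx_integralM.
- split; first by apply/mx_integralN/mx_integralM.
  rewrite mulmxA mulmxBr [T *m H *m (X1 *m w)]mulmxA THX1 -WL -mulmxA Lu mulmxDl.
  by rewrite opprD addNKr.
have -> : (pi ^ k *: (beta *m Y1 *m G) - phi *m G) *m - (X2 *m w) =
    phi *m w + pi ^ k *: (- (beta *m X1 *m w) - beta *m Y1 *m G *m X2 *m w).
  rewrite mulmxN mulmxBl opprB -[phi *m G *m _]mulmxA [G *m (X2 *m w)]mulmxA GX2.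
  by rewrite mulmxBl mul1mx mulmxBr !mulmxA phiL -!scalemxAl scalerBr scalerN !addrA.
apply: mx_value_mod => //; apply: mx_integralB; first apply: mx_integralN.
  by do 2?apply: mx_integralM.
by do 4?apply: mx_integralM.
Qed.

End ZeroWitness.

(* With a coprime pair on each side of [S'], the poles of [S'] modulo integral
   matrices are those of [D + C *m S' *m B], and the poles of the inverse [S'] are
   the zeros of [S]. *)
Section PoleWitness.
Variables (p q m n : nat) (S : 'M[K]_(p, q)) (S' : 'M[K]_(q, p)).
Variables (B : 'M[K]_(p, n)) (C : 'M[K]_(m, q)) (D : 'M[K]_(m, n)).
Hypotheses (SS' : S *m S' = 1%:M) (S'S : S' *m S = 1%:M).
Hypotheses (iB : mx_integral B) (iC : mx_integral C) (iD : mx_integral D).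
Hypotheses (lc : left_coprime v S B) (rc : right_coprime v S C).
Let T := D + C *m S' *m B.

(** The functional [pi ^ k *: (phi *m C *m S')] is integral because
    [S' = N1 + S' *m B *m N2] reduces it, up to integral terms, to the integral
    [psi *m N2]. *)
Lemma zero_witness_of_pole k r : 0 < k -> pole_witness v T k r -> zero_witness v S k r.
Proof.
have [N1 [N2 [iN1 iN2 eqN]]] := lc.
move=> k_gt0 [phi [psi [u [[iphi phiT] ipsi iu vpsiu]]]].
have phiCSB : pi ^ k *: (phi *m C *m S' *m B) = psi - pi ^ k *: (phi *m D).
  have -> : psi = pi ^ k *: (phi *m T).
    by rewrite phiT scalerA -expfzDr ?param_neq0 // subrr scale1r.
  by rewrite mulmxDr scalerDr addrC addKr !mulmxA.
have S'E : S' = N1 + S' *m B *m N2.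
  by rewrite -[S' in LHS]mulmx1 -eqN mulmxDr !mulmxA S'S mul1mx.
exists (pi ^ k *: (phi *m C *m S')), (phi *m C), (S' *m B *m u), (B *m u); split.
- split; last by rewrite -scalemxAl -mulmxA S'S mulmx1.
  rewrite S'E mulmxDr scalerDr; apply: mx_integralD.
    by apply: mx_integral_paramZ => //; do 2?apply: mx_integralM.
  rewrite !mulmxA scalemxAl phiCSB; apply: mx_integralM => //; apply: mx_integralB => //.
  by apply: mx_integral_paramZ => //; apply: mx_integralM.
- exact: mx_integralM.
- by split; [apply: mx_integralM | rewrite !mulmxA SS' mul1mx].
rewrite -scalemxAl mulmxA scalemxAl phiCSB mulmxBl -scalemxAl -scalerN.
by apply: mx_value_mod => //; apply: mx_integralN; do 2?apply: mx_integralM.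
Qed.

(** Here [beta *m S' = pi ^ (- k) *: phi], and [M2 *m C *m S' = S' - M1] lets
    [beta *m M2] see this pole through [T]. *)
Lemma pole_witness_of_zero k r : 0 < k -> zero_witness v S k r -> pole_witness v T k r.
Proof.
have [N1 [N2 [iN1 iN2 eqN]]] := lc; have [M1 [M2 [iM1 iM2 eqM]]] := rc.
move=> k_gt0 [phi [beta [u [w [[iphi phiS] ibeta [iw Su] vphiw]]]]].
have betaS' : beta *m S' = pi ^ (- k) *: phi.
  rewrite -[phi in RHS]mulmx1 -SS' mulmxA phiS -scalemxAl scalerA -expfzDr ?param_neq0 //.
  by rewrite addNr scale1r.
have M2CS' : M2 *m C *m S' = S' - M1.
  by rewrite -[S' in RHS]mul1mx -eqM mulmxDl -[M1 *m S *m S']mulmxA SS' mulmx1 addrC addKr.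
have BN2 : B *m N2 = 1%:M - S *m N1 by rewrite -eqN addrC addKr.
pose E := beta *m M2 *m D - beta *m M1 *m B.
have iE : mx_integral E by apply: mx_integralB; do 2?apply: mx_integralM.
exists (beta *m M2), (phi *m B + pi ^ k *: E), (N2 *m w); split.
- split; first exact: mx_integralM.
  have -> : beta *m M2 *m T = beta *m M2 *m D + (beta *m S' - beta *m M1) *m B.
    by rewrite mulmxDr -mulmxBr -M2CS' !mulmxA.
  rewrite betaS' scalerDr scalerA -expfzDr ?param_neq0 // addNr scale1r mulmxBl -scalemxAl.
  by rewrite addrCA.
- by apply: mx_integralD; [apply: mx_integralM | apply: mx_integral_paramZ].
- exact: mx_integralM.
have -> : (phi *m B + pi ^ k *: E) *m (N2 *m w) =
    phi *m w + pi ^ k *: (E *m (N2 *m w) - beta *m N1 *m w).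
  rewrite mulmxDl -scalemxAl -[phi *m B *m _]mulmxA [B *m (N2 *m w)]mulmxA BN2.
  rewrite mulmxBl mul1mx mulmxBr !mulmxA phiS -!scalemxAl scalerBr.
  by rewrite -!addrA; congr (_ + _); rewrite addrC.
apply: mx_value_mod => //; apply: mx_integralB; first by do 2?apply: mx_integralM.
by do 2?apply: mx_integralM.
Qed.

End PoleWitness.

End Local.

Section PointSystem.
Variables (F : fieldType) (x : point F).
Local Notation pp := (point_place x).

Lemma zero_structure_realization p q m n (L : 'M[ratfun F]_(p, q))
    (T : 'M[ratfun F]_(m, n)) G H Z W :
  realizes L T G H Z W -> mx_integral pp G -> mx_integral pp H ->
  left_coprime pp L G -> right_coprime pp L H ->
  zero_structure T x = zero_structure L x.
Proof.
move=> real iG iH lc rc; apply: zero_structure_eq => k r k_gt0; split.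
  exact: zero_witness_realization real iG iH lc _ _ k_gt0.
exact: zero_witness_transfer real iG lc rc _ _ k_gt0.
Qed.

Lemma polar_structure_realization p q m n (S : 'M[ratfun F]_(p, q)) S' B C (D : 'M_(m, n)) :
  S *m S' = 1%:M -> S' *m S = 1%:M ->
  mx_integral pp B -> mx_integral pp C -> mx_integral pp D ->
  left_coprime pp S B -> right_coprime pp S C ->
  polar_structure (D + C *m S' *m B) x = zero_structure S x.
Proof.
move=> SS' S'S iB iC iD lc rc; apply: polar_zero_structure_eq => k r k_gt0; split.
  exact: zero_witness_of_pole.
exact: pole_witness_of_zero.
Qed.

End PointSystem.

(** * Minimal indices *)

Section Degrees.
Variable F : fieldType.

Lemma ratmx_inj p q : injective (@ratmx F p q).
Proof.
move=> M N eqMN; apply/matrixP => i j; move/matrixP/(_ i j): eqMN; rewrite !mxE.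
by move/eqP; rewrite tofrac_eq => /eqP.
Qed.

Lemma vdegree_leP p q (u : 'M[{poly F}]_(p, q)) k :
  reflect (forall i j, (size (u i j) <= k.+1)%N) (vdegree u <= k)%N.
Proof.
apply: (iffP idP) => [le_k i j | le_k].
  suff : ((size (u i j)).-1 <= k)%N by case: (size _).
  apply: leq_trans le_k; apply: leq_trans (bigop.leq_bigmax i).
  exact: (bigop.leq_bigmax j).
apply/bigmax_leqP => i _; apply/bigmax_leqP => j _.
by have := le_k i j; case: (size _).
Qed.

(** The degree of a polynomial is the order of its pole at infinity. *)
Lemma size_value_at_infinity (p : {poly F}) k :
  (size p <= k.+1)%N <->
  exists c, value_at ((frac 'X)^-1 ^+ k * frac p) InfinitePoint c.
Proof.
have X0 : frac ('X^k) != 0 :> ratfun F by rewrite tofrac_eq0 -size_poly_gt0 size_polyXn.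
have eq_quo : (frac 'X)^-1 ^+ k * frac p = frac p / frac 'X^k :> ratfun F.
  by rewrite mulrC exprVn -tofracXn.
split=> [le_k | [c [n [e [eq_ne [e0 le_ne _]]]]]].
  exists (p`_(size ('X^k : {poly F})).-1 / lead_coef ('X^k : {poly F})); exists p, 'X^k.
  by rewrite eq_quo size_polyXn -size_poly_gt0 size_polyXn.
have e0' : frac e != 0 :> ratfun F by rewrite tofrac_eq0.
have := eqr_div (frac p) (frac n) X0 e0'.
rewrite -eq_quo eq_ne eqxx -(tofracM p e) -(tofracM n 'X^k) tofrac_eq => /esym/eqP eq_pe.
have [-> | p0] := eqVneq p 0; first by rewrite size_poly0.
have n0 : n != 0.
  by apply: contraNneq (mulf_neq0 p0 e0) => n0; rewrite eq_pe n0 mul0r.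
have := congr1 (size : {poly F} -> nat) eq_pe; rewrite size_mulXn // size_mul // => sz.
rewrite -(leq_add2r (size e)) (leq_trans (leqSpred _)) // sz.
by rewrite addSn ltnS leq_add2l.
Qed.

Lemma polynomial_value_at p q (u : 'M[{poly F}]_(p, q)) a :
  mx_integral (point_place (FinitePoint a)) (ratmx u).
Proof.
apply: mx_integralP => i j; exists (u i j).[a]; exists (u i j), 1.
by rewrite mxE tofrac1 divr1 !hornerE oner_eq0 divr1.
Qed.

End Degrees.

(** In lowest terms, a denominator that is not constant has a root, where the
    fraction has no value. *)
Lemma bounded_polynomial (F : closedFieldType) (f : ratfun F) :
  (forall a, exists c, value_at f (FinitePoint a) c) -> exists p, f = frac p.
Proof.
have [n [e [e0 eq_f]]] := ratfun_quotient f => bnd.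
pose g := gcdp n e; pose n1 := n %/ g; pose e1 := e %/ g.
have g0 : g != 0 by rewrite gcdp_eq0 negb_and e0 orbT.
have en : n = n1 * g by rewrite divpK ?dvdp_gcdl.
have ee : e = e1 * g by rewrite divpK ?dvdp_gcdr.
have cop : coprimep e1 n1 by rewrite coprimep_sym coprimep_div_gcd // e0 orbT.
have e10 : e1 != 0 by apply: contraNneq e0 => e10; rewrite ee e10 mul0r.
have fe10 : frac e1 != 0 :> ratfun F by rewrite tofrac_eq0.
have fg0 : frac g != 0 :> ratfun F by rewrite tofrac_eq0.
have eq_f1 : f = frac n1 / frac e1.
  rewrite eq_f en ee (tofracM n1 g) (tofracM e1 g) -[RHS]mulr1 -(divff fg0).
  exact/esym/mulf_div.
have [se1 | se1] := boolP (size e1 == 1); last first.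
  have [a ra] := closed_rootP _ se1; have [c [n' [e' [eq_f' [ea _]]]]] := bnd a.
  have fe'0 : frac e' != 0 :> ratfun F.
    by rewrite tofrac_eq0; apply: contraNneq ea => ->; rewrite horner0.
  have := eqr_div (frac n1) (frac n') fe10 fe'0.
  rewrite -eq_f1 eq_f' eqxx -(tofracM n1 e') -(tofracM n' e1) tofrac_eq => /esym/eqP eq_ne.
  have := congr1 (horner^~ a) eq_ne; rewrite !hornerM (rootP ra) mulr0 => /eqP.
  by rewrite mulf_eq0 (negPf ea) orbF (negPf (coprimep_root cop ra)).
have [c c0 eq_c] := size_poly1P _ se1.
exists (c^-1 *: n1); rewrite eq_f1 eq_c -mul_polyC (tofracM c^-1%:P n1) [RHS]mulrC.
congr (_ * _); have fc0 : frac c%:P != 0 :> ratfun F by rewrite tofrac_eq0 polyC_eq0.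
by apply: (mulfI fc0); rewrite divff // -(tofracM c%:P c^-1%:P) -polyCM divff // polyC1
  tofrac1.
Qed.

Section LiftDegree.
Variable F : closedFieldType.

(** Integral multipliers at the finite points create no denominator, and an
    integral multiplier at infinity does not raise the degree. The multiplier may
    depend on the point. *)
Lemma polynomial_lift p q r (u : 'M[{poly F}]_(p, r)) (N : 'M[ratfun F]_(q, r)) :
  (forall x, exists2 Y : 'M_(q, p), mx_integral (point_place x) Y & N = Y *m ratmx u) ->
  exists2 w, ratmx w = N & (vdegree w <= vdegree u)%N.
Proof.
move=> locN; have polyN i j : exists w, N i j = frac w.
  apply: bounded_polynomial => a; have [Y iY ->] := locN (FinitePoint a).
  have [E vE] := mx_integralM iY (polynomial_value_at u a).
  by exists (E i j); apply: vE.
have [w wE] := choice (fun ij : 'I_q * 'I_r => polyN ij.1 ij.2).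
have eqN : ratmx (\matrix_(i, j) w (i, j)) = N by apply/matrixP => i j;
  rewrite !mxE -(wE (i, j)).
exists (\matrix_(i, j) w (i, j)) => //; apply/vdegree_leP => i j.
apply/size_value_at_infinity; have [Y iY eqY] := locN InfinitePoint.
have iu : mx_integral (point_place InfinitePoint) ((frac 'X)^-1 ^+ vdegree u *: ratmx u).
  apply: mx_integralP => k l; rewrite !mxE; apply/size_value_at_infinity.
  exact/vdegree_leP.
have [E vE] := mx_integralM iY iu; exists (E i j); have := vE i j.
by rewrite -scalemxAr -eqY !mxE (wE (i, j)).
Qed.

End LiftDegree.

Section MinimalIndices.
Variables (F : fieldType) (p q p' q' : nat).
Implicit Types (V : {vspace 'M[ratfun F]_(p, q)}) (W : {vspace 'M[ratfun F]_(p', q')}).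

(** Degrees are preserved exactly, since neither of two mutually inverse maps
    raises them. *)
Lemma polynomial_basis_transfer V W (f : 'Hom(_, _)) (g : 'Hom(_, _)) b :
  (forall a, a \in V -> f a \in W /\ g (f a) = a) ->
  (forall c, c \in W -> g c \in V /\ f (g c) = c) ->
  (forall u, ratmx u \in V ->
     exists2 w, ratmx w = f (ratmx u) & (vdegree w <= vdegree u)%N) ->
  (forall w, ratmx w \in W ->
     exists2 u, ratmx u = g (ratmx w) & (vdegree u <= vdegree w)%N) ->
  polynomial_basis V b ->
  exists2 b', polynomial_basis W b' & [seq vdegree w | w <- b'] = [seq vdegree u | u <- b].
Proof.
move=> fV gW liftf liftg basisb.
have /choice[h hP] u : exists w, ratmx u \in V ->
  ratmx w = f (ratmx u) /\ vdegree w = vdegree u.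
  have [Vu | nVu] := boolP (ratmx u \in V); last by exists 0 => Vu; case/negP: nVu.
  have [w wE le_wu] := liftf u Vu; exists w => _; split=> //.
  have [fu gfu] := fV _ Vu; have [|u' u'E le_uw] := liftg w; first by rewrite wE.
  apply/eqP; rewrite eqn_leq le_wu; move: u'E le_uw; rewrite wE gfu => /ratmx_inj->.
  by [].
have memb u : u \in b -> ratmx u \in V by move=> bu; apply: (basis_mem basisb);
  apply: map_f.
exists (map h b); last first.
  by rewrite -map_comp; apply/eq_in_map => u /memb/hP[].
have fVW : (f @: V)%VS = W.
  apply/vspaceP => c; apply/memv_imgP/idP => [[a Va ->]|Wc]; first by case: (fV a).
  by have [gc fgc] := gW c Wc; exists (g c).
rewrite /polynomial_basis -fVW.
have -> : [seq ratmx w | w <- map h b] = map f [seq ratmx u | u <- b].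
  by rewrite -!map_comp; apply/eq_in_map => u /memb/hP[].
apply: limg_basis_of => //; apply/eqP; rewrite -subv0.
apply/subvP => a; rewrite memv_cap memv_ker memv0 => /andP[Va /eqP fa0].
by have [_ <-] := fV a Va; rewrite fa0 linear0.
Qed.

End MinimalIndices.

(** Minimal bases correspond with their lists of degrees; the lists of minimal
    indices are then chosen from the same set. *)
Lemma minimal_indices_iso (F : fieldType) p q p' q' (V : {vspace 'M[ratfun F]_(p, q)})
    (W : {vspace 'M[ratfun F]_(p', q')}) (f : 'Hom(_, _)) (g : 'Hom(_, _)) :
  (forall a, a \in V -> f a \in W /\ g (f a) = a) ->
  (forall c, c \in W -> g c \in V /\ f (g c) = c) ->
  (forall u, ratmx u \in V ->
     exists2 w, ratmx w = f (ratmx u) & (vdegree w <= vdegree u)%N) ->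
  (forall w, ratmx w \in W ->
     exists2 u, ratmx u = g (ratmx w) & (vdegree u <= vdegree w)%N) ->
  minimal_indices V = minimal_indices W.
Proof.
move=> fV gW liftf liftg.
have VW := polynomial_basis_transfer fV gW liftf liftg.
have WV := polynomial_basis_transfer gW fV liftg liftf.
have sumE p1 q1 (b : seq 'M[{poly F}]_(p1, q1)) :
  (\sum_(v <- b) vdegree v = sumn [seq vdegree v | v <- b])%N by rewrite sumnE big_map.
rewrite /minimal_indices; congr (xget _ _); apply/seteqP; split=> s [b [basisb minb] ->].
  have [c basisc eq_bc] := VW _ basisb; exists c; last by rewrite eq_bc.
  split=> // b' /WV[c' basisc' eq_bc']; rewrite !sumE eq_bc -eq_bc' -!sumE.
  exact: minb.
have [c basisc eq_bc] := WV _ basisb; exists c; last by rewrite eq_bc.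
split=> // b' /VW[c' basisc' eq_bc']; rewrite !sumE eq_bc -eq_bc' -!sumE.
exact: minb.
Qed.

Lemma right_null_spaceP (F : fieldType) p q (M : 'M[ratfun F]_(p, q)) a :
  reflect (M *m a = 0) (a \in right_null_space M).
Proof. by rewrite memv_ker lfunE; apply: eqP. Qed.

Lemma left_null_spaceP (F : fieldType) p q (M : 'M[ratfun F]_(p, q)) a :
  reflect (a *m M = 0) (a \in left_null_space M).
Proof. by rewrite memv_ker lfunE; apply: eqP. Qed.

Lemma left_minimal_indices_tr (F : fieldType) p q (M : 'M[ratfun F]_(p, q)) :
  left_minimal_indices M = right_minimal_indices M^T.
Proof.
have vdegree_tr p1 q1 (u : 'M[{poly F}]_(p1, q1)) : (vdegree u^T <= vdegree u)%N.
  by apply/vdegree_leP => i j; rewrite mxE; apply/vdegree_leP.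
have [f fE] : exists f : 'Hom('rV[ratfun F]_p, 'cV[ratfun F]_p), forall a, f a = a^T.
  by exists (linfun trmx) => a; rewrite lfunE.
have [g gE] : exists g : 'Hom('cV[ratfun F]_p, 'rV[ratfun F]_p), forall a, g a = a^T.
  by exists (linfun trmx) => a; rewrite lfunE.
apply: (@minimal_indices_iso F 1 p p 1 (left_null_space M) (right_null_space M^T) f g).
- move=> a /left_null_spaceP aM; rewrite fE gE trmxK; split=> //.
  by apply/right_null_spaceP; rewrite -trmx_mul aM trmx0.
- move=> a /right_null_spaceP aM; rewrite fE gE trmxK; split=> //.
  by apply/left_null_spaceP; rewrite -[M]trmxK -trmx_mul aM trmx0.
- by move=> u _; exists u^T => //; rewrite fE /ratmx map_trmx.
- by move=> u _; exists u^T => //; rewrite gE /ratmx map_trmx.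
Qed.

Section SystemIndices.
Variables (F : closedFieldType) (p q m n : nat).
Implicit Types (L : 'M[ratfun F]_(p, q)) (T : 'M[ratfun F]_(m, n)).

(** [Z] maps the kernel of [T] onto that of [L], with inverse [H]. By
    [coprime_decomp], [Z] agrees on the kernel of [T] with the matrix [Y2] of a
    Bezout identity, which can be taken integral at any given point. *)
Lemma right_minimal_indices_realization L T G H Z W : realizes L T G H Z W ->
  (forall x, mx_integral (point_place x) H) ->
  (forall x, right_coprime (point_place x) L H) ->
  right_minimal_indices T = right_minimal_indices L.
Proof.
move=> real iH rc; have [LZ HZ WL WG] := real.
have [f fE] : exists f : 'Hom('cV[ratfun F]_n, 'cV[ratfun F]_q), forall a, f a = Z *m a.
  by exists (linfun (mulmx Z)) => a; rewrite lfunE.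
have [g gE] : exists g : 'Hom('cV[ratfun F]_q, 'cV[ratfun F]_n), forall c, g c = H *m c.
  by exists (linfun (mulmx H)) => c; rewrite lfunE.
apply: (@minimal_indices_iso F n 1 q 1 (right_null_space T) (right_null_space L) f g).
- move=> a /right_null_spaceP Ta; rewrite gE fE; split; last by rewrite mulmxA HZ mul1mx.
  by apply/right_null_spaceP; rewrite mulmxA LZ mulNmx -mulmxA Ta mulmx0 oppr0.
- move=> c /right_null_spaceP Lc; rewrite fE gE.
  have THc : T *m (H *m c) = 0 by rewrite mulmxA -WL -mulmxA Lc mulmx0.
  split; first exact/right_null_spaceP.
  have [Y1 [Y2 [_ _ eqY]]] := rc InfinitePoint.
  rewrite (coprime_decomp real eqY) mulmxBl -(mulmxA (Y1 *m G)) THc mulmx0 subr0.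
  by rewrite -[RHS]mul1mx -eqY mulmxDl -!mulmxA Lc mulmx0 add0r.
- move=> u /right_null_spaceP Tu; rewrite fE; apply: polynomial_lift => x.
  have [Y1 [Y2 [_ iY2 eqY]]] := rc x; exists Y2 => //.
  by rewrite (coprime_decomp real eqY) mulmxBl -(mulmxA (Y1 *m G)) Tu mulmx0 subr0.
- by move=> w _; rewrite gE; apply: polynomial_lift => x; exists H.
Qed.

End SystemIndices.

Lemma left_minimal_indices_realization (F : closedFieldType) p q m n
  (L : 'M[ratfun F]_(p, q))
    (T : 'M[ratfun F]_(m, n)) G H Z W : realizes L T G H Z W ->
  (forall x, mx_integral (point_place x) G) ->
  (forall x, left_coprime (point_place x) L G) ->
  left_minimal_indices T = left_minimal_indices L.
Proof.
move=> /realizes_tr real iG lc; rewrite !left_minimal_indices_tr.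
apply: right_minimal_indices_realization real _ _ => x.
  exact/mx_integralN/mx_integral_tr.
exact: right_coprime_tr.
Qed.

(** * Absorbing constant terms by bordering *)

(* At infinity, all four blocks of a linear system pencil may have poles, so that
   the poles of the transfer function are not those of the inverse of the first
   block. The bordered matrix [S] realizes [T] with an input matrix and an output
   matrix that are integral as soon as [J] and [E] are. *)
Section Bordered.
Variables (K F : fieldType) (v : place K F) (p q m n : nat).
Variables (L : 'M[K]_(p, q)) (T : 'M[K]_(m, n)) (G : 'M[K]_(p, m)) (H : 'M[K]_(n, q)).
Variables (Z : 'M[K]_(q, n)) (W : 'M[K]_(m, p)) (J : 'M[K]_(p, n)) (E : 'M[K]_(m, q)).
Hypothesis real : realizes L T G H Z W.

Let S : 'M_(p + n, q + m) := block_mx (L - J *m H - G *m E) G H 0.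
Let B : 'M_(p + n, n) := col_mx (- J) 1%:M.
Let C : 'M_(m, q + m) := row_mx (- E) 1%:M.

(** Solving for the last block first leaves the Bezout identity of [L] and [G]
    with right-hand side [(1, J)]. *)
Lemma bordered_left_coprime :
  mx_integral v J -> mx_integral v E -> mx_integral v H ->
  left_coprime v L G -> left_coprime v S B.
Proof.
move=> iJ iE iH [X1 [X2 [iX1 iX2 eqX]]].
pose U : 'M_(q, p + n) := X1 *m row_mx 1%:M J.
have iJ1 : mx_integral v (row_mx 1%:M J) by apply: mx_integral_row => //;
  apply: mx_integral1.
have iU : mx_integral v U by apply: mx_integralM.
exists (col_mx U (X2 *m row_mx 1%:M J + E *m U)), (row_mx 0 1%:M - H *m U); split.
- by apply: mx_integral_col => //; apply: mx_integralD; apply: mx_integralM.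
- apply: mx_integralB; last exact: mx_integralM.
  by apply: mx_integral_row; [apply: mx_integral0 | apply: mx_integral1].
rewrite mul_block_col mul0mx addr0 mul_col_mx mul1mx add_col_mx.
rewrite [H *m U + _]addrC subrK scalar_mx_block /block_mx; congr col_mx.
transitivity ((L *m X1 + G *m X2) *m row_mx 1%:M J - J *m row_mx 0 1%:M); last first.
  by rewrite eqX mul1mx mul_mx_row mulmx0 mulmx1 opp_row_mx add_row_mx oppr0 addr0 subrr.
rewrite mulmxDl -!mulmxA -/U mulmxDr mulNmx mulmxBr !mulmxBl !mulmxA.
move: (L *m U) (J *m H *m U) (G *m E *m U) (J *m row_mx 0 1%:M) (G *m X2 *m row_mx 1%:M J).
by move=> a b c e f; apply/matrixP => i j; rewrite !mxE; ring.
Qed.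

Lemma bordered_right_coprime :
  mx_integral v J -> mx_integral v E -> mx_integral v G ->
  right_coprime v L H -> right_coprime v S C.
Proof.
move=> iJ iE iG [Y1 [Y2 [iY1 iY2 eqY]]].
pose U : 'M_(q + m, p) := col_mx 1%:M E *m Y1.
have iE1 : mx_integral v (col_mx 1%:M E) by apply: mx_integral_col => //;
  apply: mx_integral1.
have iU : mx_integral v U by apply: mx_integralM.
exists (row_mx U (col_mx 1%:M E *m Y2 + U *m J)), (col_mx 0 1%:M - U *m G); split.
- by apply: mx_integral_row => //; apply: mx_integralD; apply: mx_integralM.
- apply: mx_integralB; last exact: mx_integralM.
  by apply: mx_integral_col; [apply: mx_integral0 | apply: mx_integral1].
rewrite mul_row_block mulmx0 addr0 mul_mx_row mulmx1 add_row_mx.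
rewrite [U *m G + _]addrC subrK scalar_mx_block block_mxEh; congr row_mx.
transitivity (col_mx 1%:M E *m (Y1 *m L + Y2 *m H) - col_mx 0 1%:M *m E); last first.
  by rewrite eqY mulmx1 mul_col_mx mul0mx mul1mx opp_col_mx add_col_mx oppr0 addr0 subrr.
rewrite mulmxDr !mulmxA -/U mulmxDl mulmxN mulmxBl !mulmxBr !mulmxA.
move: (U *m L) (U *m J *m H) (U *m G *m E) (col_mx 0 1%:M *m E) (col_mx 1%:M E *m Y2 *m H).
by move=> a b c e f; apply/matrixP => i j; rewrite !mxE; ring.
Qed.

Lemma bordered_mul_right : S *m col_mx Z (T + E *m Z) = B.
Proof.
have [LZ HZ _ _] := real; rewrite mul_block_col mul0mx addr0 HZ; congr col_mx.
rewrite !mulmxBl LZ mulmxDr -!mulmxA HZ mulmx1.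
move: (G *m T) (G *m (E *m Z)) => a b.
by apply/matrixP => i j; rewrite !mxE; ring.
Qed.

Lemma bordered_mul_left : row_mx (- W) (T - W *m J) *m S = C.
Proof.
have [_ _ WL WG] := real; rewrite mul_row_block mulmx0 addr0 !mulNmx WG opprK; congr row_mx.
rewrite !mulmxBr WL mulmxBl !mulmxA WG mulNmx mul1mx.
move: (T *m H) (W *m J *m H) => a b.
by apply/matrixP => i j; rewrite !mxE; ring.
Qed.

(** Since [S] maps [col_mx Z (T + E *m Z)] to [B], its Bezout identity on the left
    provides a right inverse. The other one provides a left inverse; both are
    needed because the shape of [S] does not tell that it is square. *)
Lemma bordered_invertible : left_coprime v S B -> right_coprime v S C ->
  exists S', S *m S' = 1%:M /\ S' *m S = 1%:M.
Proof.
move=> [N1 [N2 [_ _ eqN]]] [M1 [M2 [_ _ eqM]]].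
have invr : S *m (N1 + col_mx Z (T + E *m Z) *m N2) = 1%:M.
  by rewrite mulmxDr mulmxA bordered_mul_right eqN.
have invl : (M1 + M2 *m row_mx (- W) (T - W *m J)) *m S = 1%:M.
  by rewrite mulmxDl -mulmxA bordered_mul_left eqM.
exists (N1 + col_mx Z (T + E *m Z) *m N2); split=> //; move: invl invr.
set N := N1 + _; set M := M1 + _ => invl invr.
by rewrite -[N]mul1mx -invl -(mulmxA M) invr mulmx1.
Qed.

Lemma bordered_transfer S' : S' *m S = 1%:M -> T = 0 + C *m S' *m B.
Proof.
move=> invl; have [_ HZ _ _] := real.
rewrite -bordered_mul_right -!mulmxA (mulmxA S') invl mul1mx mul_row_col mul1mx add0r.
by rewrite mulNmx addrC addrK.
Qed.

End Bordered.

Lemma polar_structure_bordered (F : fieldType) (x : point F) p q m n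
    (L : 'M[ratfun F]_(p, q)) (T : 'M[ratfun F]_(m, n)) G H Z W
    (J : 'M[ratfun F]_(p, n)) (E : 'M[ratfun F]_(m, q)) :
  realizes L T G H Z W ->
  mx_integral (point_place x) G -> mx_integral (point_place x) H ->
  mx_integral (point_place x) J -> mx_integral (point_place x) E ->
  left_coprime (point_place x) L G -> right_coprime (point_place x) L H ->
  polar_structure T x = zero_structure (block_mx (L - J *m H - G *m E) G H 0) x.
Proof.
move=> real iG iH iJ iE lc rc.
have lcS := bordered_left_coprime iJ iE iH lc;
  have rcS := bordered_right_coprime iJ iE iG rc.
have [S' [invr invl]] := bordered_invertible real lcS rcS.
rewrite [T](bordered_transfer real invl).
have i1 k : mx_integral (point_place x) (1%:M : 'M_k) by apply: mx_integral1.
apply: polar_structure_realization => //; last exact: mx_integral0.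
  by apply: mx_integral_col => //; apply: mx_integralN.
by apply: mx_integral_row => //; apply: mx_integralN.
Qed.

(** * Linear system pencils *)

Lemma left_coprimeP (K F : fieldType) (v : place K F) p q m (L : 'M[K]_(p, q))
    (G : 'M[K]_(p, m)) :
  left_coprime v L G <-> exists X, mx_integral v X /\ row_mx L G *m X = 1%:M.
Proof.
split=> [[X1 [X2 [iX1 iX2 eqX]]] | [X [iX eqX]]].
  by exists (col_mx X1 X2); split; [apply: mx_integral_col | rewrite mul_row_col].
exists (usubmx X), (dsubmx X); rewrite -mul_row_col vsubmxK.
by split=> //; rewrite (usubmxEsub, dsubmxEsub); apply: mx_integral_sub.
Qed.

Lemma right_coprimeP (K F : fieldType) (v : place K F) p q n (L : 'M[K]_(p, q))
    (H : 'M[K]_(n, q)) :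
  right_coprime v L H <-> exists X, mx_integral v X /\ (col_mx L H)^T *m X = 1%:M.
Proof.
rewrite tr_col_mx -left_coprimeP; split=> -[X1 [X2 [iX1 iX2 eqX]]].
  exists X1^T, X2^T; split; try exact: mx_integral_tr.
  by rewrite -!trmx_mul -linearD /= eqX trmx1.
exists X1^T, X2^T; split; try exact: mx_integral_tr.
by apply: trmx_inj; rewrite linearD /= !trmx_mul !trmxK eqX trmx1.
Qed.

Lemma ratmx_row (F : fieldType) p q r (P : 'M[{poly F}]_(p, q)) (Q : 'M_(p, r)) :
  ratmx (row_mx P Q) = row_mx (ratmx P) (ratmx Q).
Proof. exact: map_row_mx. Qed.

Lemma ratmx_col (F : fieldType) p q r (P : 'M[{poly F}]_(p, q)) (Q : 'M_(r, q)) :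
  ratmx (col_mx P Q) = col_mx (ratmx P) (ratmx Q).
Proof. exact: map_col_mx. Qed.

Lemma ratmx_block (F : fieldType) p q r s (P : 'M[{poly F}]_(p, q)) (Q : 'M_(p, r))
    (U : 'M_(s, q)) (V : 'M_(s, r)) :
  ratmx (block_mx P Q U V) = block_mx (ratmx P) (ratmx Q) (ratmx U) (ratmx V).
Proof. exact: map_block_mx. Qed.

Lemma ratmxN (F : fieldType) p q (P : 'M[{poly F}]_(p, q)) : ratmx (- P) = - ratmx P.
Proof. exact: map_mxN. Qed.

Lemma ratmx0 (F : fieldType) p q : ratmx (0 : 'M[{poly F}]_(p, q)) = 0.
Proof. exact: map_mx0. Qed.

Lemma ratmx_tr (F : fieldType) p q (P : 'M[{poly F}]_(p, q)) : ratmx P^T = (ratmx P)^T.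
Proof. by rewrite /ratmx map_trmx. Qed.

Section SystemPencil.
Variables (F : fieldType) (d m n : nat).
Variables (A : 'M[{poly F}]_d) (B : 'M[{poly F}]_(d, n)).
Variables (C : 'M[{poly F}]_(m, d)) (D : 'M[{poly F}]_(m, n)).
Hypothesis regA : \det A != 0.

Local Notation a := (ratmx A).
Local Notation b := (ratmx B).
Local Notation c := (ratmx C).
Local Notation e := (ratmx D).
Let L := ratmx (system_pencil A B C D).
Let T := transfer_function A B C D.
Let G : 'M[ratfun F]_(d + m, m) := col_mx 0 (- 1%:M).
Let H : 'M[ratfun F]_(n, d + n) := row_mx 0 1%:M.
Let Z : 'M[ratfun F]_(d + n, n) := col_mx (invmx a *m b) 1%:M.
Let W : 'M[ratfun F]_(m, d + m) := row_mx (- (c *m invmx a)) 1%:M.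

Lemma ratmx_regular : a \in unitmx.
Proof. by rewrite unitmxE unitfE /ratmx det_map_mx tofrac_eq0. Qed.

Lemma ratmx_system : L = block_mx a (- b) c e.
Proof. by rewrite /L /ratmx map_block_mx map_mxN. Qed.

Lemma system_realizes : realizes L T G H Z W.
Proof.
have ua := ratmx_regular; rewrite ratmx_system; split.
- rewrite mul_block_col !mulmx1 mulmxA mulmxV // mul1mx subrr mul_col_mx mul0mx mulNmx
  mul1mx.
  by rewrite opp_col_mx oppr0 opprK mulmxA addrC.
- by rewrite mul_row_col mul0mx add0r mul1mx.
- rewrite mul_row_block !mul1mx mul_mx_row mulmx0 mulmx1 !mulNmx mulmxKV // addNr.
  by rewrite mulmxN opprK addrC.
- by rewrite mul_row_col mulmx0 add0r mul1mx.
Qed.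

Lemma system_row_free : row_free (row_mx L G).
Proof.
have ua := ratmx_regular.
apply/row_freeP; exists (col_mx (block_mx (invmx a) 0 0 0)
  (row_mx (c *m invmx a) (- 1%:M))).
rewrite mul_row_col ratmx_system mulmx_block mul_col_row add_block_mx !mulmx0 !mul0mx
  !addr0.
by rewrite mulmxV // !mulNmx !mul1mx addrN add0r opprK -scalar_mx_block.
Qed.

Lemma system_col_free : row_free (col_mx L H)^T.
Proof.
have ua := ratmx_regular.
rewrite /row_free mxrank_tr; suff /eqP: row_full (col_mx L H) by move->.
apply/row_fullP; exists (row_mx (block_mx (invmx a) 0 0 0) (col_mx (invmx a *m b) 1%:M)).
rewrite mul_row_col ratmx_system mulmx_block mul_col_row add_block_mx !mulmx0 !mul0mx
  !addr0.
by rewrite mulVmx // !mulmx1 mulmxN addNr !add0r -scalar_mx_block.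
Qed.

Lemma ratmx_G : ratmx (col_mx 0 (- 1%:M)) = G.
Proof. by rewrite /ratmx map_col_mx map_mx0 map_mxN map_mx1. Qed.

Lemma ratmx_H : ratmx (row_mx 0 1%:M) = H.
Proof. by rewrite /ratmx map_row_mx map_mx0 map_mx1. Qed.

Lemma integral_G x : mx_integral (point_place x) G.
Proof.
by apply: mx_integral_col; [apply: mx_integral0 | apply/mx_integralN/mx_integral1].
Qed.

Lemma integral_H x : mx_integral (point_place x) H.
Proof. by apply: mx_integral_row; [apply: mx_integral0 | apply: mx_integral1]. Qed.

Lemma has_no_zeros_row :
  has_no_zeros (ratmx (row_mx (system_pencil A B C D) (col_mx 0 (- 1%:M)))) <->
  forall x, left_coprime (point_place x) L G.
Proof.
rewrite ratmx_row ratmx_G; apply: (iff_trans (has_no_zerosP system_row_free)).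
by split=> lc x; apply/left_coprimeP/lc.
Qed.

Lemma has_no_zeros_col :
  has_no_zeros (ratmx (col_mx (system_pencil A B C D) (row_mx 0 1%:M))) <->
  forall x, right_coprime (point_place x) L H.
Proof.
rewrite ratmx_col ratmx_H; apply: (iff_trans (iff_sym (has_no_zeros_tr _))).
apply: (iff_trans (has_no_zerosP system_col_free)).
by split=> rc x; apply/right_coprimeP/rc.
Qed.

(** Both bordered pencils have full rank, as elimination with [A] shows, so that
    [has_no_zerosP] turns the absence of zeros into Bezout identities. *)
Lemma strongly_irreducibleP : strongly_irreducible A B C D <->
  forall x, left_coprime (point_place x) L G /\ right_coprime (point_place x) L H.
Proof.
split=> [[/has_no_zeros_row lc /has_no_zeros_col rc] x // | co].
by split; [apply/has_no_zeros_row | apply/has_no_zeros_col] => x; case: (co x).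
Qed.

Lemma left_coprime_block x :
  left_coprime (point_place x) L G -> left_coprime (point_place x) a b.
Proof.
move=> [X1 [X2 [iX1 iX2]]];
  rewrite ratmx_system -[X1]submxK -[X2]hsubmxK mulmx_block mul_col_row.
rewrite add_block_mx scalar_mx_block mul0mx addr0 => /eq_block_mx[eqX _ _ _].
exists (ulsubmx X1), (- dlsubmx X1); rewrite mulmxN -mulNmx; split=> //.
  by rewrite ulsubmxEsub; apply: mx_integral_sub.
by apply: mx_integralN; rewrite dlsubmxEsub; apply: mx_integral_sub.
Qed.

Lemma right_coprime_block x :
  right_coprime (point_place x) L H -> right_coprime (point_place x) a c.
Proof.
move=> [Y1 [Y2 [iY1 iY2]]];
  rewrite ratmx_system -[Y1]submxK -[Y2]vsubmxK mulmx_block mul_col_row.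
rewrite add_block_mx scalar_mx_block mulmx0 addr0 => /eq_block_mx[eqY _ _ _].
exists (ulsubmx Y1), (ursubmx Y1); split=> //.
  by rewrite ulsubmxEsub; apply: mx_integral_sub.
by rewrite ursubmxEsub; apply: mx_integral_sub.
Qed.

Lemma system_zero_structure x : strongly_irreducible A B C D ->
  zero_structure T x = zero_structure L x.
Proof.
move=> /strongly_irreducibleP/(_ x)[lc rc].
exact: zero_structure_realization system_realizes (integral_G x) (integral_H x) lc rc.
Qed.

(** At a finite point, [B], [C] and [D] are integral, and [A] itself carries the
    poles. *)
Lemma system_finite_polar_structure r : strongly_irreducible A B C D ->
  polar_structure T (FinitePoint r) = zero_structure a (FinitePoint r).
Proof.
move=> /strongly_irreducibleP/(_ (FinitePoint r))[lc rc]; have ua := ratmx_regular.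
apply: polar_structure_realization; rewrite ?mulmxV ?mulVmx //;
  try exact: polynomial_value_at.
  exact: left_coprime_block.
exact: right_coprime_block.
Qed.

End SystemPencil.

Section StronglyMinimalPencils.
Variable F : fieldType.

Definition degree_le1 p q (P : 'M[{poly F}]_(p, q)) : Prop :=
  forall i j, (size (P i j) <= 2)%N.

Lemma degree_le1_pencil p q (P1 P0 : 'M[F]_(p, q)) : degree_le1 (pencil P1 P0).
Proof.
move=> i j; rewrite !mxE; apply: leq_trans (size_polyD _ _) _; rewrite geq_max size_polyN.
rewrite (leq_trans (size_polyMleq _ _)) ?size_polyX /=; last first.
  exact: size_polyC_leq1.
by rewrite (leq_trans (size_polyC_leq1 _)).
Qed.

Lemma degree_le1_row p q r (P : 'M[{poly F}]_(p, q)) (Q : 'M_(p, r)) :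
  degree_le1 P -> degree_le1 Q -> degree_le1 (row_mx P Q).
Proof. by move=> dP dQ i j; rewrite mxE; case: split. Qed.

Lemma degree_le1N p q (P : 'M[{poly F}]_(p, q)) : degree_le1 P -> degree_le1 (- P).
Proof. by move=> dP i j; rewrite mxE size_polyN. Qed.

Lemma degree_le1_tr p q (P : 'M[{poly F}]_(p, q)) : degree_le1 P -> degree_le1 P^T.
Proof. by move=> dP i j; rewrite mxE. Qed.

(** A pencil has a pole of order at most one at infinity. Multiplying it by the
    local parameter turns its leading coefficient into its value there, whose
    rank decides about the infinite eigenvalue. *)
Lemma pencil_scaling (x : point F) p q (P : 'M[{poly F}]_(p, q)) :
  degree_le1 P -> has_no_eigenvalues P ->
  row_free (ratmx P) ->
  exists (s : ratfun F), [/\ exists k, value_at s x k,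
    exists2 P0, mx_value (point_place x) (s *: ratmx P) P0 & row_free P0 &
    forall r (Q : 'M[{poly F}]_(r, q)), degree_le1 Q ->
      mx_integral (point_place x) (s *: ratmx Q)].
Proof.
move=> dP [fin inf] /eqP freeP; have le_row k (N : 'M[F]_(p, k)) := rank_leq_row N.
case: x => [r|].
  exists 1; split; first by exists 1; apply: value_at1.
    exists (map_mx (horner_eval r) P).
      move=> i j; rewrite scale1r !mxE; exists (P i j), 1.
      by rewrite tofrac1 divr1 !hornerE oner_eq0 divr1.
    rewrite /row_free eqn_leq le_row leqNgt; apply/negP => lt_p; apply: (fin r).
    by rewrite /finite_eigenvalue normal_rankE freeP.
  by move=> k Q _; rewrite scale1r; apply: polynomial_value_at.
have val (f : {poly F}) : (size f <= 2)%N ->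
  value_at ((frac 'X)^-1 * frac f) InfinitePoint f`_1.
  move=> df; exists f, 'X; rewrite mulrC size_polyX lead_coefX divr1; split=> //.
  by split=> //; rewrite polyX_eq0.
exists (frac 'X)^-1; split; first by exists 0;
  apply: (value_at_local_parameter InfinitePoint).
  exists (map_mx (coefp 1) P); first by move=> i j; rewrite !mxE; apply: val.
  rewrite /row_free eqn_leq le_row leqNgt; apply/negP => lt_p; apply: inf.
  by rewrite /infinite_eigenvalue normal_rankE freeP.
by move=> k Q dQ; apply: mx_integralP => i j; exists (Q i j)`_1; rewrite !mxE; apply: val.
Qed.

(** The inverse found absorbs the scaling factor, which is why its product with
    any other pencil stays integral. *)
Lemma pencil_right_inverse (x : point F) p q (P : 'M[{poly F}]_(p, q)) r
  (Q : 'M[{poly F}]_(r, q)) :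
  degree_le1 P -> degree_le1 Q -> has_no_eigenvalues P -> row_free (ratmx P) ->
  exists N : 'M_(q, p), [/\ mx_integral (point_place x) N, ratmx P *m N = 1%:M &
     mx_integral (point_place x) (ratmx Q *m N)].
Proof.
move=> dP dQ eigP freeP.
have [s [[k vs] [P0 vP0 /row_freeP[N0 PN0]] scaleQ]] := pencil_scaling x dP eigP freeP.
have [M vM] := mx_value_lift (point_place x) N0.
have iM : mx_integral (point_place x) M by exists N0.
have := mx_valueM vP0 vM; rewrite PN0 => v1.
have [u1 iV] := mx_value_unit v1 (unitmx1 _ _).
set V := invmx _ in iV; have MV : mx_integral (point_place x) (M *m V)
  by apply: mx_integralM.
exists (s *: (M *m V)); split.
- exact: (mx_integralZ (v := point_place x) vs).
- by rewrite -scalemxAr scalemxAl mulmxA mulmxV.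
- by rewrite -scalemxAr scalemxAl; apply: mx_integralM => //; apply: scaleQ.
Qed.

Lemma has_no_eigenvalues_tr p q (P : 'M[{poly F}]_(p, q)) :
  has_no_eigenvalues P -> has_no_eigenvalues P^T.
Proof.
move=> [fin inf]; split=> [r ev|ev]; [apply: (fin r) | apply: inf]; move: ev.
  by rewrite /finite_eigenvalue !normal_rankE ratmx_tr -map_trmx !mxrank_tr.
by rewrite /infinite_eigenvalue !normal_rankE ratmx_tr -map_trmx !mxrank_tr.
Qed.

Section StronglyMinimal.
Variables (d m n : nat) (A : 'M[{poly F}]_d) (B : 'M[{poly F}]_(d, n)).
Variables (C : 'M[{poly F}]_(m, d)) (D : 'M[{poly F}]_(m, n)).
Hypotheses (regA : \det A != 0) (dA : degree_le1 A) (dB : degree_le1 B).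
Hypotheses (dC : degree_le1 C) (dD : degree_le1 D).

Lemma strongly_minimal_left_coprime x : has_no_eigenvalues (row_mx A (- B)) ->
  left_coprime (point_place x) (ratmx (system_pencil A B C D))
    (col_mx 0 (- 1%:M) : 'M_(_, m)).
Proof.
move=> eigAB; have ua := ratmx_regular regA.
have free : row_free (ratmx (row_mx A (- B))).
  apply/row_freeP; exists (col_mx (invmx (ratmx A)) 0).
  by rewrite ratmx_row mul_row_col mulmx0 addr0 mulmxV.
have [N [iN PN iQN]] := pencil_right_inverse x (degree_le1_row dA (degree_le1N dB))
  (degree_le1_row dC dD) eigAB free.
(* The second factor cancels the lower rows of the product of the pencil with [N]
   and supplies the lower right identity block. *)
exists (row_mx N 0), (row_mx (ratmx (row_mx C D) *m N) (- 1%:M)); split.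
- by apply: mx_integral_row => //; apply: mx_integral0.
- by apply: mx_integral_row => //; apply/mx_integralN/mx_integral1.
rewrite /system_pencil block_mxEv ratmx_col mul_col_row mul_col_row mulmx0 PN.
rewrite !mulmx0 !mul0mx !mulNmx !mul1mx opprK add_block_mx !addr0 add0r.
by rewrite addrN -scalar_mx_block.
Qed.

Lemma strongly_minimal_right_coprime x : has_no_eigenvalues (col_mx A C) ->
  right_coprime (point_place x) (ratmx (system_pencil A B C D)) (row_mx 0 1%:M : 'M_(n, _)).
Proof.
move=> /has_no_eigenvalues_tr; rewrite tr_col_mx => eigAC; have ua := ratmx_regular regA.
have free : row_free (ratmx (row_mx A^T C^T)).
  apply/row_freeP; exists (col_mx (invmx (ratmx A))^T 0).
  by rewrite ratmx_row mul_row_col mulmx0 addr0 ratmx_tr -trmx_mul mulVmx // trmx1.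
have [N [iN PN iQN]] := pencil_right_inverse x
  (degree_le1_row (degree_le1_tr dA) (degree_le1_tr dC))
  (degree_le1_row (degree_le1_tr (degree_le1N dB)) (degree_le1_tr dD)) eigAC free.
have NP : N^T *m ratmx (col_mx A C) = 1%:M.
  by rewrite -[ratmx _]trmxK -ratmx_tr tr_col_mx -trmx_mul PN trmx1.
have iNQ : mx_integral (point_place x) (N^T *m ratmx (col_mx (- B) D)).
  rewrite -[ratmx _]trmxK -ratmx_tr tr_col_mx -trmx_mul.
  exact: mx_integral_tr.
exists (col_mx N^T 0), (col_mx (- (N^T *m ratmx (col_mx (- B) D))) 1%:M); split.
- by apply: mx_integral_col; [apply: mx_integral_tr | apply: mx_integral0].
- by apply: mx_integral_col; [apply: mx_integralN | apply: mx_integral1].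
rewrite /system_pencil block_mxEh ratmx_row mul_col_row mul_col_row mul0mx NP.
rewrite !mulmx0 !mul0mx !mulmx1 add_block_mx !addr0 add0r.
by rewrite addrN -scalar_mx_block.
Qed.

End StronglyMinimal.

End StronglyMinimalPencils.

(** The constant terms of [B], [C] and [D] are integral at infinity. Subtracting
    them by bordering the system matrix leaves the pencil of the statement. *)
Lemma infinite_polar_structure (F : fieldType) d m n (A0 A1 : 'M[F]_d)
    (B0 B1 : 'M[F]_(d, n))
    (C0 C1 : 'M[F]_(m, d)) (D0 D1 : 'M[F]_(m, n)) :
  let A := pencil A1 A0 in let B := pencil B1 B0 in
  let C := pencil C1 C0 in let D := pencil D1 D0 in
  \det A != 0 -> strongly_irreducible A B C D ->
  polar_structure (transfer_function A B C D) InfinitePoint =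
    zero_structure (ratmx (infinite_pole_pencil A B1 C1 D1)) InfinitePoint.
Proof.
move=> A B C D regA /(strongly_irreducibleP _ _ _ regA)/(_ InfinitePoint)[lc rc].
pose cst p q (M : 'M[F]_(p, q)) : 'M[ratfun F]_(p, q) := ratmx (map_mx polyC M).
have icst p q (M : 'M[F]_(p, q)) : mx_integral (point_place InfinitePoint) (cst p q M).
  by apply: mx_integralP => i j; exists (M i j); rewrite !mxE; apply: value_atC.
have pencilE p q (P1 P0 : 'M[F]_(p, q)) :
    ratmx (pencil P1 P0) = ratmx (pencil P1 0) - cst p q P0.
  by apply/matrixP => i j; rewrite !mxE subr0 tofracB.
(* The constant terms of the blocks [B] and [D] are multiples of [(0, 1)], those of
   [C] are multiples of [(0; - 1)]. *)
pose J := col_mx (cst _ _ B0) (- cst _ _ D0); pose E := row_mx (cst _ _ C0) (0 : 'M_(m, n)).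
have -> : ratmx (infinite_pole_pencil A B1 C1 D1) =
    block_mx (ratmx (system_pencil A B C D) - J *m row_mx 0 1%:M - col_mx 0 (- 1%:M) *m E)
      (col_mx 0 (- 1%:M)) (row_mx 0 1%:M) 0.
  rewrite /infinite_pole_pencil ratmx_block ratmx_G ratmx_H ratmx0; congr block_mx.
  rewrite /system_pencil !ratmx_block !ratmxN mul_col_row mul_col_row !mulmx0 !mulmx1
    !mul0mx.
  rewrite !mulNmx !mul1mx opp_block_mx add_block_mx opp_block_mx add_block_mx.
  rewrite !(oppr0, addr0, opprK).
  by rewrite (pencilE _ _ B1 B0) (pencilE _ _ C1 C0) (pencilE _ _ D1 D0) opprB addrAC
    subrr add0r !subrK.
apply: (polar_structure_bordered (system_realizes B C D regA)) => //.
- exact: integral_G.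
- exact: integral_H.
- by apply: mx_integral_col => //; apply: mx_integralN.
- by apply: mx_integral_row => //; apply: mx_integral0.
Qed.

Theorem theorem5 (R : realType) (d m n : nat)
    (A0 A1 : 'M[R[i]]_d) (B0 B1 : 'M[R[i]]_(d, n))
    (C0 C1 : 'M[R[i]]_(m, d)) (D0 D1 : 'M[R[i]]_(m, n)) :
  let A := pencil A1 A0 in
  let B := pencil B1 B0 in
  let C := pencil C1 C0 in
  let D := pencil D1 D0 in
  let L := ratmx (system_pencil A B C D) in
  let T := transfer_function A B C D in
  \det A != 0 ->
  (strongly_minimal A B C -> strongly_irreducible A B C D) /\
  (strongly_irreducible A B C D ->
   [/\ forall x : point R[i], zero_structure T x = zero_structure L x,
       left_minimal_indices T = left_minimal_indices L /\
       right_minimal_indices T = right_minimal_indices L,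
       forall a : R[i],
         polar_structure T (FinitePoint a) = zero_structure (ratmx A) (FinitePoint a) &
       polar_structure T InfinitePoint =
         zero_structure (ratmx (infinite_pole_pencil A B1 C1 D1)) InfinitePoint]).
Proof.
move=> A B C D L T regA; split=> [[eigAB eigAC] | irr].
  apply/(strongly_irreducibleP _ _ _ regA) => x; split.
    by apply: strongly_minimal_left_coprime => //; apply: degree_le1_pencil.
  by apply: strongly_minimal_right_coprime => //; apply: degree_le1_pencil.
have co := (strongly_irreducibleP _ _ _ regA).1 irr.
have real := system_realizes B C D regA.
split.
- by move=> x; apply: system_zero_structure.
- split.
    by apply: (left_minimal_indices_realization real) => x;
      [apply: integral_G | case: (co x)].
  by apply: (right_minimal_indices_realization real) => x;
    [apply: integral_H | case: (co x)].
- by move=> a; apply: system_finite_polar_structure.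
- exact: infinite_polar_structure.
Qed.
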